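(* For all sets $\Gamma, \Delta \subseteq \mathcal{MD}$ of modal formulas and for every individual variable $x \in Ind$, we have $\Gamma \models_{\mathsf{FSK}^d} \Delta$ if and only if $\sigma\tau_x(\Gamma)\models_{\mathsf{QN4}}\sigma\tau_x(\Delta)$, where $\sigma\tau_x(\Gamma)=\{\sigma\tau_x(\phi)\mid\phi\in\Gamma\}$ and likewise for $\Delta$.
   Context: **Modal language.** $Prop=\{p_n\mid n\in\omega\}$. $\mathcal{MD}$ is generated from $Prop$ by $\wedge,\vee,\to,\sim,\Box$. **The logic $\mathsf{FSK}^d$** (the $\mathsf{N4}$-based modal logic of Odintsov and Wansing, taken over $\mathcal{MD}$, with $\Diamond\phi$ definable as $\sim\Box\sim\phi$). A model is $\mathcal{M}=(W,\leq,R,V^+,V^-)$ with $W\neq\emptyset$, $\leq$ a preorder on $W$, $V^+,V^-$ mapping $Prop$ to $\leq$-upward closed subsets of $W$, and $R\subseteq W\times W$ such that: if $w\leq w'$ and $R(w,v)$, then there is $v'$ with $R(w',v')$ and $v\leq v'$; and if $R(w,v)$ and $v\leq v'$, then there is $w'\geq w$ with $R(w',v')$. Relations $\models^+,\models^-$ are defined by simultaneous induction: - $w\models^\star p$ iff $w\in V^\star(p)$, for $\star\in\{+,-\}$; - $w\models^+\sim\psi$ iff $w\models^-\psi$; $w\models^-\sim\psi$ iff $w\models^+\psi$; - $w\models^+\psi\wedge\chi$ iff $w\models^+\psi$ and $w\models^+\chi$; $w\models^-\psi\wedge\chi$ iff $w\models^-\psi$ or $w\models^-\chi$; - $w\models^+\psi\vee\chi$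 iff $w\models^+\psi$ or $w\models^+\chi$; $w\models^-\psi\vee\chi$ iff $w\models^-\psi$ and $w\models^-\chi$; - $w\models^+\psi\to\chi$ iff for all $v\geq w$, $v\models^+\psi$ implies $v\models^+\chi$; $w\models^-\psi\to\chi$ iff $w\models^+\psi$ and $w\models^-\chi$; - $w\models^+\Box\psi$ iff for all $v\geq w$ and all $u$, $R(v,u)$ implies $u\models^+\psi$; $w\models^-\Box\psi$ iff there is $u$ with $R(w,u)$ and $u\models^-\psi$. $\Gamma\models_{\mathsf{FSK}^d}\Delta$ means: there is no $(\mathcal M,w)$ with $\mathcal M,w\models^+\phi$ for all $\phi\in\Gamma$ and $\mathcal M,w\not\models^+\psi$ for all $\psi\in\Delta$. **First-order language.** $Ind=\{v_n\mid n\in\omega\}$ is the set of variables. $\Pi$ consists of unary predicates $p_n$ ($n\in\omega$; identified with the elements of $Prop$), unary $S,O$, binary $E$, ternary $R$. $\mathcal{FO}$ is generated from atoms $x\equiv y$ and $Q(x_1,\ldots,x_n)$ ($Q\in\Pi$) by $\wedge,\vee,\to,\sim,\forall x,\exists x$. $\phi\leftrightarrow\psi:=(\phi\to\psi)\wedge(\psi\to\phi)$. $\phi[x/y]$ is the result of replacing the free occurrences of $x$ in $\phi$ by $y$. **The logic $\mathsf{QN4}$.** It is given by the axiom schemes: $\phi\to(\psi\to\phi)$; $(\phi\to(\psi\to\chi))\to((\phi\to\psi)\to(\phi\to\chi))$; $(\phi\wedge\psi)\to\phi$; $(\phi\wedge\psi)\to\psi$; $\phi\to(\psi\to(\phi\wedge\psi))$;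 $\phi\to(\phi\vee\psi)$; $\psi\to(\phi\vee\psi)$; $(\phi\to\chi)\to((\psi\to\chi)\to((\phi\vee\psi)\to\chi))$; $\forall x\phi\to\phi[x/y]$; $\phi[x/y]\to\exists x\phi$; $x\equiv x$; $y\equiv z\to(\phi[x/y]\to\phi[x/z])$ ($y,z$ substitutable for $x$ in $\phi$); $\sim\sim\phi\leftrightarrow\phi$; $\sim(\phi\wedge\psi)\leftrightarrow(\sim\phi\vee\sim\psi)$; $\sim(\phi\vee\psi)\leftrightarrow(\sim\phi\wedge\sim\psi)$; $\sim(\phi\to\psi)\leftrightarrow(\phi\wedge\sim\psi)$; $\sim\exists x\theta\leftrightarrow\forall x\sim\theta$; $\sim\forall x\theta\leftrightarrow\exists x\sim\theta$; and the rules: (MP) from $\phi$ and $\phi\to\psi$ infer $\psi$; from $\psi\to\phi[x/y]$ infer $\psi\to\forall x\phi$; from $\phi[x/y]\to\psi$ infer $\exists x\phi\to\psi$ (in the last two, $y$ is substitutable for $x$ in $\phi$, and $y$ is free neither in $\psi$ nor in $\forall x\phi$). $\phi$ is provable iff it ends a finite sequence of formulas each of which is an axiom or follows from earlier ones by a rule. For $\Gamma,\Delta\subseteq\mathcal{FO}$, $\Gamma\models_{\mathsf{QN4}}\Delta$ means: there is a finite sequence of formulas, each in $\Gamma$, or provable, or obtained from earlier ones by (MP), whose last element is $\theta_1\vee\ldots\vee\theta_s$ for some $\theta_1,\ldots,\theta_s\in\Delta$ ($s\geq1$). **Modal standard translation.** For every $x\in Ind$ fix some $y\in Ind$ distinct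 from $x$. Then $\sigma\tau_x(p):=p(x)$; $\sigma\tau_x(\sim\psi):=\;\sim\sigma\tau_x(\psi)$; $\sigma\tau_x(\psi\ast\chi):=\sigma\tau_x(\psi)\ast\sigma\tau_x(\chi)$ for $\ast\in\{\wedge,\vee,\to\}$; $\sigma\tau_x(\Box\psi):=\forall y(Exy\to\sigma\tau_y(\psi))$. *)

(* Defs.v *)
From Stdlib Require Export List Ensembles Image RelationClasses.
From Stdlib Require Import PeanoNat.
Export ListNotations.

(** * The modal language and FSK^d *)

Inductive MD : Type :=
| MProp (n : nat)
| MAnd (phi psi : MD)
| MOr (phi psi : MD)
| MImp (phi psi : MD)
| MNeg (phi : MD)
| MBox (phi : MD).

Record fsk_model : Type := {
  world : Type;
  world_inhabited : inhabited world;
  le : world -> world -> Prop;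
  le_preorder : PreOrder le;
  acc : world -> world -> Prop;
  Vpos : nat -> world -> Prop;
  Vneg : nat -> world -> Prop;
  Vpos_up : forall n w w', le w w' -> Vpos n w -> Vpos n w';
  Vneg_up : forall n w w', le w w' -> Vneg n w -> Vneg n w';
  acc_forth : forall w w' v, le w w' -> acc w v ->
    exists v', acc w' v' /\ le v v';
  acc_back : forall w v v', acc w v -> le v v' ->
    exists w', le w w' /\ acc w' v'
}.

Arguments le {_} _ _.
Arguments acc {_} _ _.
Arguments Vpos {_} _ _.
Arguments Vneg {_} _ _.

Fixpoint sat_pos (M : fsk_model) (w : world M) (phi : MD) {struct phi} : Prop :=
  match phi with
  | MProp n => Vpos n w
  | MAnd psi chi => sat_pos M w psi /\ sat_pos M w chi
  | MOr psi chi => sat_pos M w psi \/ sat_pos M w chi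
  | MImp psi chi => forall v, le w v -> sat_pos M v psi -> sat_pos M v chi
  | MNeg psi => sat_neg M w psi
  | MBox psi => forall v u, le w v -> acc v u -> sat_pos M u psi
  end
with sat_neg (M : fsk_model) (w : world M) (phi : MD) {struct phi} : Prop :=
  match phi with
  | MProp n => Vneg n w
  | MAnd psi chi => sat_neg M w psi \/ sat_neg M w chi
  | MOr psi chi => sat_neg M w psi /\ sat_neg M w chi
  | MImp psi chi => sat_pos M w psi /\ sat_neg M w chi
  | MNeg psi => sat_pos M w psi
  | MBox psi => exists u, acc w u /\ sat_neg M u psi
  end.

Definition FSKd_conseq (Gamma Delta : Ensemble MD) : Prop :=
  ~ exists (M : fsk_model) (w : world M),
      (forall phi, In MD Gamma phi -> sat_pos M w phi) /\
      (forall psi, In MD Delta psi -> ~ sat_pos M w psi).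

(** * The first-order language *)

(* The variable v_n is represented by n, and the unary predicate p_n
   by FProp n. *)
Inductive FO : Type :=
| FProp (n : nat) (x : nat)
| FS (x : nat)
| FOb (x : nat) (* the unary predicate O *)
| FE (x y : nat)
| FR (x y z : nat)
| FEq (x y : nat)
| FAnd (phi psi : FO)
| FOr (phi psi : FO)
| FImp (phi psi : FO)
| FNeg (phi : FO)
| FAll (x : nat) (phi : FO)
| FEx (x : nat) (phi : FO).

Definition FIff (phi psi : FO) : FO := FAnd (FImp phi psi) (FImp psi phi).

Fixpoint free (x : nat) (phi : FO) : Prop :=
  match phi with
  | FProp _ a | FS a | FOb a => x = a
  | FE a b | FEq a b => x = a \/ x = b
  | FR a b c => x = a \/ x = b \/ x = c
  | FAnd psi chi | FOr psi chi | FImp psi chi => free x psi \/ free x chi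
  | FNeg psi => free x psi
  | FAll z psi | FEx z psi => x <> z /\ free x psi
  end.

Definition rename (x y a : nat) : nat := if Nat.eqb a x then y else a.

(* [subst x y phi] is phi[x/y]: the free x becomes y, with no renaming of
   bound variables. *)
Fixpoint subst (x y : nat) (phi : FO) : FO :=
  match phi with
  | FProp n a => FProp n (rename x y a)
  | FS a => FS (rename x y a)
  | FOb a => FOb (rename x y a)
  | FE a b => FE (rename x y a) (rename x y b)
  | FR a b c => FR (rename x y a) (rename x y b) (rename x y c)
  | FEq a b => FEq (rename x y a) (rename x y b)
  | FAnd psi chi => FAnd (subst x y psi) (subst x y chi)
  | FOr psi chi => FOr (subst x y psi) (subst x y chi)
  | FImp psi chi => FImp (subst x y psi) (subst x y chi)
  | FNeg psi => FNeg (subst x y psi)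
  | FAll z psi => FAll z (if Nat.eqb z x then psi else subst x y psi)
  | FEx z psi => FEx z (if Nat.eqb z x then psi else subst x y psi)
  end.

(* y is substitutable for x in phi: no free occurrence of x in phi lies in the
   scope of a quantifier binding y. *)
Fixpoint substitutable (y x : nat) (phi : FO) : Prop :=
  match phi with
  | FProp _ _ | FS _ | FOb _ | FE _ _ | FR _ _ _ | FEq _ _ => True
  | FAnd psi chi | FOr psi chi | FImp psi chi =>
      substitutable y x psi /\ substitutable y x chi
  | FNeg psi => substitutable y x psi
  | FAll z psi | FEx z psi =>
      x = z \/ ~ free x psi \/ (y <> z /\ substitutable y x psi)
  end.

(** * The Hilbert system QN4 *)

Inductive QN4_axiom : FO -> Prop :=
| ax_K phi psi : QN4_axiom (FImp phi (FImp psi phi))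
| ax_Frege phi psi chi :
    QN4_axiom (FImp (FImp phi (FImp psi chi))
                    (FImp (FImp phi psi) (FImp phi chi)))
| ax_and_l phi psi : QN4_axiom (FImp (FAnd phi psi) phi)
| ax_and_r phi psi : QN4_axiom (FImp (FAnd phi psi) psi)
| ax_and_i phi psi : QN4_axiom (FImp phi (FImp psi (FAnd phi psi)))
| ax_or_l phi psi : QN4_axiom (FImp phi (FOr phi psi))
| ax_or_r phi psi : QN4_axiom (FImp psi (FOr phi psi))
| ax_or_e phi psi chi :
    QN4_axiom (FImp (FImp phi chi)
                    (FImp (FImp psi chi) (FImp (FOr phi psi) chi)))
| ax_all x y phi : substitutable y x phi ->
    QN4_axiom (FImp (FAll x phi) (subst x y phi))
| ax_ex x y phi : substitutable y x phi ->
    QN4_axiom (FImp (subst x y phi) (FEx x phi))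
| ax_eq_refl x : QN4_axiom (FEq x x)
| ax_eq_subst x y z phi : substitutable y x phi -> substitutable z x phi ->
    QN4_axiom (FImp (FEq y z) (FImp (subst x y phi) (subst x z phi)))
| ax_neg_neg phi : QN4_axiom (FIff (FNeg (FNeg phi)) phi)
| ax_neg_and phi psi :
    QN4_axiom (FIff (FNeg (FAnd phi psi)) (FOr (FNeg phi) (FNeg psi)))
| ax_neg_or phi psi :
    QN4_axiom (FIff (FNeg (FOr phi psi)) (FAnd (FNeg phi) (FNeg psi)))
| ax_neg_imp phi psi :
    QN4_axiom (FIff (FNeg (FImp phi psi)) (FAnd phi (FNeg psi)))
| ax_neg_ex x theta :
    QN4_axiom (FIff (FNeg (FEx x theta)) (FAll x (FNeg theta)))
| ax_neg_all x theta :
    QN4_axiom (FIff (FNeg (FAll x theta)) (FEx x (FNeg theta))).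

(* In the next three definitions, the list holds the formulas that occur
   earlier in a sequence. *)
Definition by_MP (earlier : list FO) (psi : FO) : Prop :=
  exists phi, List.In phi earlier /\ List.In (FImp phi psi) earlier.

Definition by_gen_all (earlier : list FO) (theta : FO) : Prop :=
  exists x y phi psi,
    theta = FImp psi (FAll x phi) /\
    substitutable y x phi /\ ~ free y psi /\ ~ free y (FAll x phi) /\
    List.In (FImp psi (subst x y phi)) earlier.

Definition by_gen_ex (earlier : list FO) (theta : FO) : Prop :=
  exists x y phi psi,
    theta = FImp (FEx x phi) psi /\
    substitutable y x phi /\ ~ free y psi /\ ~ free y (FAll x phi) /\
    List.In (FImp (subst x y phi) psi) earlier.

(* Some finite sequence ending in phi has each of its members justified, given
   the list of the members before it, by [step]. *)
Definition ends_deduction (step : list FO -> FO -> Prop) (phi : FO) : Prop :=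
  exists s : list FO,
    forall earlier psi later,
      s ++ [phi] = earlier ++ psi :: later -> step earlier psi.

Definition QN4_provable : FO -> Prop :=
  ends_deduction (fun earlier phi =>
    QN4_axiom phi \/ by_MP earlier phi \/
    by_gen_all earlier phi \/ by_gen_ex earlier phi).

Definition QN4_conseq (Gamma Delta : Ensemble FO) : Prop :=
  exists (theta : FO) (thetas : list FO),
    In FO Delta theta /\ Forall (In FO Delta) thetas /\
    ends_deduction (fun earlier phi =>
      In FO Gamma phi \/ QN4_provable phi \/ by_MP earlier phi)
      (fold_left FOr thetas theta).

(** * The standard translation *)

(* [other x] is the variable, distinct from x, chosen for x. *)
Fixpoint std_trans (other : nat -> nat) (x : nat) (phi : MD) : FO :=
  match phi with
  | MProp n => FProp n x
  | MAnd psi chi => FAnd (std_trans other x psi) (std_trans other x chi)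
  | MOr psi chi => FOr (std_trans other x psi) (std_trans other x chi)
  | MImp psi chi => FImp (std_trans other x psi) (std_trans other x chi)
  | MNeg psi => FNeg (std_trans other x psi)
  | MBox psi =>
      FAll (other x) (FImp (FE x (other x)) (std_trans other (other x) psi))
  end.

(* Main.v *)
Require Import Defs.
From Stdlib Require Import Arith Lia FinFun Setoid Classical ClassicalEpsilon Cantor.

(** The clauses for [sat_pos] and [sat_neg] read a model of FSK^d as a Kripke
    model of first-order N4 in which a world together with a point of the domain
    has been packed into one modal world, and in which a box is a quantifier over
    [E]-successors.  Each direction makes one half of this reading precise.

    From modal to first-order consequence ([FSKd_to_QN4]) one argues by
    completeness.  If no disjunction of translations from [Delta] is derivable,
    extend the translations of [Gamma] to a prime theory with witnesses.  Only
    formulas of the form of a translation at a variable, or of an atom [E a b],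
    matter, so a theory is a set of such labelled formulas, the labels being
    variables.  The pairs of a saturated theory and a label form a model of FSK^d:
    the order enlarges the theory and keeps the label, accessibility follows the
    atoms [E a b] and keeps the theory, and both confluence conditions hold for
    that reason.  The Hilbert system enters through introduction and elimination
    rules for the box and the negated box at arbitrary labels ([box_intro],
    [box_elim], [neg_box_intro], [neg_box_elim]).  The obstacle there is
    variable capture: the translation chooses its bound variables by [other],
    which may clash with a label.  It is overcome by [std_trans_fresh]: up to
    equivalence of a formula and of its negation, the bound variables can be
    taken above any given bound.

    From first-order to modal consequence ([QN4_to_FSKd]) one argues by
    soundness.  QN4 is sound for Kripke models with constant domains, so it
    suffices to turn a model M of FSK^d into such a model that forces the
    translations as M satisfies the modal formulas ([unravelled_truth]).  Its
    individuals are the nodes of a fixed tree, its stages are the partial maps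
    from the tree to M that send edges to the accessibility relation and hit every
    successor of every point in their range.  A later stage maps each node
    higher and may be defined on more nodes.  To force implications and boxes
    correctly, any point of such a map must be movable upwards to any given world
    above it ([lift]).  This uses both confluence conditions of M: one moves the
    ancestors of the node along with it, the other moves all remaining nodes.
    Nodes on which a map is not yet defined have no edges, hence are invisible to
    the quantifiers of the translation; this is why the domain may be constant. *)

(** * Deductions as inductive predicates *)

Section Deductions.

Variable step : list FO -> FO -> Prop.

(** The members of a deduction inherit any property that the justification
    [step] passes on from the earlier members to the next. *)
Lemma ends_deduction_ind (P : FO -> Prop) :
  (forall earlier psi,
     (forall chi, List.In chi earlier -> P chi) -> step earlier psi -> P psi) ->
  forall phi, ends_deduction step phi -> P phi.
Proof.
  intros Hstep phi [s Hs].
  assert (H : forall n earlier psi later,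
    s ++ [phi] = earlier ++ psi :: later -> length earlier < n -> P psi).
  { induction n as [|n IH]; intros earlier psi later E Hlen; [lia|].
    apply (Hstep earlier); [|exact (Hs _ _ _ E)].
    intros chi Hchi. apply in_split in Hchi as (l1 & l2 & ->).
    apply (IH l1 chi (l2 ++ psi :: later)).
    - now rewrite E, <- app_assoc.
    - rewrite length_app in Hlen. simpl in Hlen. lia. }
  exact (H (S (length s)) s phi [] eq_refl (Nat.lt_succ_diag_r _)).
Qed.

Hypothesis step_mono : forall l l' psi, incl l l' -> step l psi -> step l' psi.

(** Deductions of the premises can be written one after the other, because a
    justification survives the insertion of further members. *)
Lemma ends_deduction_step premises phi :
  Forall (ends_deduction step) premises -> step premises phi ->
  ends_deduction step phi.
Proof.
  set (valid s := forall earlier psi later,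
    s = earlier ++ psi :: later -> step earlier psi).
  assert (valid_app : forall s s', valid s -> valid s' -> valid (s ++ s')).
  { intros s s' Hs Hs' earlier psi later E.
    apply app_eq_app in E as [l [[-> E]|[-> E]]].
    - destruct l as [|chi l]; simpl in E.
      + apply (step_mono []); [easy|].
        now apply (Hs' [] psi later).
      + injection E as -> ->. now apply (Hs earlier chi l).
    - apply (step_mono l); [now apply incl_appr|]. now apply (Hs' l psi later). }
  intros Hprem Hphi.
  assert (exists s, valid s /\ incl premises s) as (s & Hs & Hincl).
  { clear Hphi. induction Hprem as [|chi l [s Hs] _ (s' & Hs' & Hincl)].
    - exists []. split; [|easy]. intros [|? ?] ? ? E; discriminate E.
    - exists ((s ++ [chi]) ++ s'). split; [now apply valid_app|].
      apply incl_cons; [|now apply incl_appr].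
      apply in_or_app. left. apply in_or_app. right. now left. }
  exists s. intros earlier psi later E.
  apply app_eq_app in E as [l [[-> E]|[-> E]]].
  - destruct l as [|chi l]; simpl in E.
    + injection E as -> ->. rewrite app_nil_r in Hincl.
      now apply (step_mono premises).
    + injection E as -> ->. now apply (Hs earlier chi l).
  - destruct l as [|chi l]; simpl in E.
    + injection E as <- <-. rewrite app_nil_r in *. now apply (step_mono premises).
    + injection E as _ E. now destruct l.
Qed.

End Deductions.

Inductive provable : FO -> Prop :=
| prov_axiom phi : QN4_axiom phi -> provable phi
| prov_mp phi psi : provable phi -> provable (FImp phi psi) -> provable psi
| prov_gen_all x y phi psi :
    substitutable y x phi -> ~ free y psi -> ~ free y (FAll x phi) ->
    provable (FImp psi (subst x y phi)) -> provable (FImp psi (FAll x phi))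
| prov_gen_ex x y phi psi :
    substitutable y x phi -> ~ free y psi -> ~ free y (FAll x phi) ->
    provable (FImp (subst x y phi) psi) -> provable (FImp (FEx x phi) psi).

Inductive derives (Gamma : FO -> Prop) : FO -> Prop :=
| der_hyp phi : Gamma phi -> derives Gamma phi
| der_provable phi : provable phi -> derives Gamma phi
| der_mp phi psi :
    derives Gamma phi -> derives Gamma (FImp phi psi) -> derives Gamma psi.

Lemma by_MP_mono l l' phi : incl l l' -> by_MP l phi -> by_MP l' phi.
Proof. intros Hl (psi & H1 & H2). exists psi. split; now apply Hl. Qed.

Lemma QN4_provable_iff phi : QN4_provable phi <-> provable phi.
Proof.
  split.
  - apply ends_deduction_ind.
    intros earlier psi IH
      [H|[(chi & H1 & H2)|[(x & y & chi & chi' & -> & H1 & H2 & H3 & H4)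
                          |(x & y & chi & chi' & -> & H1 & H2 & H3 & H4)]]].
    + now apply prov_axiom.
    + now apply (prov_mp chi); apply IH.
    + apply (prov_gen_all x y); auto.
    + apply (prov_gen_ex x y); auto.
  - intros H.
    assert (mono : forall l l' psi, incl l l' ->
      QN4_axiom psi \/ by_MP l psi \/ by_gen_all l psi \/ by_gen_ex l psi ->
      QN4_axiom psi \/ by_MP l' psi \/ by_gen_all l' psi \/ by_gen_ex l' psi).
    { intros l l' psi Hl
        [H'|[H'|[(x & y & chi & chi' & H1 & H2 & H3 & H4 & H5)
                |(x & y & chi & chi' & H1 & H2 & H3 & H4 & H5)]]]; auto.
      - right. left. now apply (by_MP_mono l).
      - right. right. left. exists x, y, chi, chi'. auto 6.
      - right. right. right. exists x, y, chi, chi'. auto 6. }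
    induction H as [phi H|phi psi _ IH1 _ IH2|x y phi psi H1 H2 H3 _ IH
                   |x y phi psi H1 H2 H3 _ IH].
    + apply (ends_deduction_step _ mono []); auto.
    + apply (ends_deduction_step _ mono [phi; FImp phi psi]); auto.
      right. left. exists phi. simpl. auto.
    + apply (ends_deduction_step _ mono [FImp psi (subst x y phi)]); auto.
      right. right. left. exists x, y, phi, psi. simpl. auto 6.
    + apply (ends_deduction_step _ mono [FImp (subst x y phi) psi]); auto.
      right. right. right. exists x, y, phi, psi. simpl. auto 6.
Qed.

Lemma QN4_conseq_iff (Gamma Delta : Ensemble FO) :
  QN4_conseq Gamma Delta <->
  exists theta thetas, In FO Delta theta /\ Forall (In FO Delta) thetas /\
    derives Gamma (fold_left FOr thetas theta).
Proof.
  split; intros (theta & thetas & H1 & H2 & H); exists theta, thetas;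
    split; [assumption| |assumption|]; (split; [assumption|]); revert H.
  - apply ends_deduction_ind. intros earlier psi IH [H|[H|(chi & H3 & H4)]].
    + now apply der_hyp.
    + apply der_provable. now apply QN4_provable_iff.
    + now apply (der_mp _ chi); apply IH.
  - assert (mono : forall l l' psi, incl l l' ->
      In FO Gamma psi \/ QN4_provable psi \/ by_MP l psi ->
      In FO Gamma psi \/ QN4_provable psi \/ by_MP l' psi).
    { intros l l' psi Hl [H|[H|H]]; auto. right. right.
      now apply (by_MP_mono l). }
    induction 1 as [phi H|phi H|phi psi _ IH1 _ IH2].
    + apply (ends_deduction_step _ mono []); auto.
    + apply (ends_deduction_step _ mono []); auto.
      right. left. now apply QN4_provable_iff.
    + apply (ends_deduction_step _ mono [phi; FImp phi psi]); auto.
      right. right. exists phi. simpl. auto.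
Qed.

(** * Derived rules of QN4 *)

Definition extend (Gamma : FO -> Prop) (phi : FO) : FO -> Prop :=
  fun chi => chi = phi \/ Gamma chi.

Definition fresh_in (y : nat) (Gamma : FO -> Prop) : Prop :=
  forall gamma, Gamma gamma -> ~ free y gamma.

Definition none : FO -> Prop := fun _ => False.

Lemma derives_mono (Gamma Gamma' : FO -> Prop) phi :
  (forall gamma, Gamma gamma -> Gamma' gamma) ->
  derives Gamma phi -> derives Gamma' phi.
Proof.
  intros Hsub. induction 1.
  - now apply der_hyp, Hsub.
  - now apply der_provable.
  - now apply (der_mp _ phi).
Qed.

Lemma derives_weaken Gamma phi psi :
  derives Gamma psi -> derives (extend Gamma phi) psi.
Proof. apply derives_mono. now right. Qed.

Lemma derives_last Gamma phi : derives (extend Gamma phi) phi.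
Proof. apply der_hyp. now left. Qed.

Lemma derives_axiom Gamma phi : QN4_axiom phi -> derives Gamma phi.
Proof. intros H. now apply der_provable, prov_axiom. Qed.

Lemma derives_none phi : derives none phi -> provable phi.
Proof.
  induction 1 as [phi []|phi H|phi psi _ IH1 _ IH2]; [exact H|].
  now apply (prov_mp phi).
Qed.

Lemma imp_intro Gamma phi psi :
  derives (extend Gamma phi) psi -> derives Gamma (FImp phi psi).
Proof.
  induction 1 as [psi [->|H]|psi H|chi psi _ IH1 _ IH2].
  - apply (der_mp _ (FImp phi (FImp phi phi))); [apply derives_axiom, ax_K|].
    apply (der_mp _ (FImp phi (FImp (FImp phi phi) phi)));
      apply derives_axiom; [apply ax_K|apply ax_Frege].
  - apply (der_mp _ psi); [now apply der_hyp|apply derives_axiom, ax_K].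
  - apply (der_mp _ psi); [now apply der_provable|apply derives_axiom, ax_K].
  - apply (der_mp _ (FImp phi chi)); [exact IH1|].
    apply (der_mp _ (FImp phi (FImp chi psi))); [exact IH2|].
    apply derives_axiom, ax_Frege.
Qed.

Lemma derives_cut Gamma phi psi :
  derives Gamma phi -> derives (extend Gamma phi) psi -> derives Gamma psi.
Proof. intros H1 H2. apply (der_mp _ phi); [exact H1|now apply imp_intro]. Qed.

Lemma by_provable Gamma phi psi :
  provable (FImp phi psi) -> derives Gamma phi -> derives Gamma psi.
Proof. intros H1 H2. apply (der_mp _ phi); [exact H2|now apply der_provable]. Qed.

Lemma by_axiom Gamma phi psi :
  QN4_axiom (FImp phi psi) -> derives Gamma phi -> derives Gamma psi.
Proof. intros H. now apply by_provable, prov_axiom. Qed.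

Lemma and_intro Gamma phi psi :
  derives Gamma phi -> derives Gamma psi -> derives Gamma (FAnd phi psi).
Proof.
  intros H1 H2. apply (der_mp _ psi); [exact H2|].
  apply (by_axiom _ phi); [apply ax_and_i|exact H1].
Qed.

Lemma and_left Gamma phi psi : derives Gamma (FAnd phi psi) -> derives Gamma phi.
Proof. apply by_axiom, ax_and_l. Qed.

Lemma and_right Gamma phi psi : derives Gamma (FAnd phi psi) -> derives Gamma psi.
Proof. apply by_axiom, ax_and_r. Qed.

Lemma or_left Gamma phi psi : derives Gamma phi -> derives Gamma (FOr phi psi).
Proof. apply by_axiom, ax_or_l. Qed.

Lemma or_right Gamma phi psi : derives Gamma psi -> derives Gamma (FOr phi psi).
Proof. apply by_axiom, ax_or_r. Qed.

Lemma or_elim Gamma phi psi chi :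
  derives (extend Gamma phi) chi -> derives (extend Gamma psi) chi ->
  derives Gamma (FOr phi psi) -> derives Gamma chi.
Proof.
  intros H1 H2 H. apply (der_mp _ (FOr phi psi)); [exact H|].
  apply (der_mp _ (FImp psi chi)); [now apply imp_intro|].
  apply (by_axiom _ (FImp phi chi)); [apply ax_or_e|now apply imp_intro].
Qed.

Lemma iff_forward Gamma phi psi :
  QN4_axiom (FIff phi psi) -> derives Gamma phi -> derives Gamma psi.
Proof.
  intros H1 H2. apply (der_mp _ phi); [exact H2|].
  eapply and_left, derives_axiom, H1.
Qed.

Lemma iff_backward Gamma phi psi :
  QN4_axiom (FIff phi psi) -> derives Gamma psi -> derives Gamma phi.
Proof.
  intros H1 H2. apply (der_mp _ psi); [exact H2|].
  eapply and_right, derives_axiom, H1.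
Qed.

(** A derivation uses finitely many hypotheses, and these can be conjoined into
    one formula with the same fresh variables.  That is the shape in which the
    generalization rules expect their side formula. *)
Lemma derives_one Gamma phi y :
  fresh_in y Gamma -> derives Gamma phi ->
  exists gamma, ~ free y gamma /\ derives Gamma gamma /\
    provable (FImp gamma phi).
Proof.
  intros Hy. induction 1 as [phi H|phi H|phi psi _ IH1 _ IH2].
  - exists phi. split; [now apply Hy|]. split; [now apply der_hyp|].
    apply derives_none, imp_intro, derives_last.
  (* any closed theorem will do as the empty conjunction *)
  - exists (FImp (FAll y (FS y)) (FAll y (FS y))). split; [simpl; tauto|].
    split; [apply imp_intro, derives_last|].
    apply derives_none, imp_intro, derives_weaken. now apply der_provable.
  - destruct IH1 as (g1 & F1 & D1 & P1), IH2 as (g2 & F2 & D2 & P2).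
    exists (FAnd g1 g2). split; [simpl; tauto|].
    split; [now apply and_intro|].
    apply derives_none, imp_intro. apply (der_mp _ phi).
    + apply (by_provable _ g1); [exact P1|].
      eapply and_left, derives_last.
    + apply (by_provable _ g2); [exact P2|].
      eapply and_right, derives_last.
Qed.

Lemma all_intro Gamma x y phi :
  substitutable y x phi -> fresh_in y Gamma -> ~ free y (FAll x phi) ->
  derives Gamma (subst x y phi) -> derives Gamma (FAll x phi).
Proof.
  intros Hs HG Hy H.
  destruct (derives_one _ _ _ HG H) as (gamma & F & D & P).
  apply (by_provable _ gamma); [|exact D]. now apply (prov_gen_all x y).
Qed.

Lemma all_elim Gamma x y phi :
  substitutable y x phi -> derives Gamma (FAll x phi) ->
  derives Gamma (subst x y phi).
Proof. intros Hs. now apply by_axiom, ax_all. Qed.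

Lemma ex_intro_rule Gamma x y phi :
  substitutable y x phi -> derives Gamma (subst x y phi) ->
  derives Gamma (FEx x phi).
Proof. intros Hs. now apply by_axiom, ax_ex. Qed.

Lemma ex_elim Gamma x y phi psi :
  substitutable y x phi -> fresh_in y Gamma -> ~ free y psi ->
  ~ free y (FAll x phi) ->
  derives (extend Gamma (subst x y phi)) psi ->
  derives Gamma (FEx x phi) -> derives Gamma psi.
Proof.
  intros Hs HG Hpsi Hy H HE. apply imp_intro in H.
  destruct (derives_one _ _ _ HG H) as (gamma & F & D & P).
  apply (der_mp _ gamma); [exact D|]. apply (by_provable _ (FEx x phi)); [|exact HE].
  apply (prov_gen_ex x y); [exact Hs|simpl; tauto|exact Hy|].
  apply derives_none, imp_intro, imp_intro.
  apply (der_mp _ (subst x y phi)); [apply derives_weaken, derives_last|].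
  apply (by_provable _ gamma); [exact P|apply derives_last].
Qed.

(** * Renaming bound variables *)

Lemma subst_same x phi : subst x x phi = phi.
Proof.
  assert (R : forall a, rename x x a = a).
  { intros a. unfold rename. destruct (Nat.eqb_spec a x); congruence. }
  induction phi; simpl; rewrite ?R; try congruence;
    destruct (Nat.eqb _ _); congruence.
Qed.

Lemma substitutable_same x phi : substitutable x x phi.
Proof.
  induction phi; simpl; auto;
    match goal with |- x = ?z \/ _ => destruct (Nat.eq_dec x z); auto end.
Qed.

Lemma subst_not_free x y phi : ~ free x phi -> subst x y phi = phi.
Proof.
  assert (R : forall a, x <> a -> rename x y a = a).
  { intros a Ha. unfold rename. destruct (Nat.eqb_spec a x); congruence. }
  induction phi as [| | | | | | | | | |z phi IH|z phi IH]; simpl; intros H;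
    rewrite ?R by tauto; try reflexivity;
    rewrite ?IHphi1, ?IHphi2, ?IHphi by tauto; try reflexivity;
    destruct (Nat.eqb_spec z x); try reflexivity; rewrite IH; auto.
Qed.

Lemma substitutable_not_free x y phi : ~ free x phi -> substitutable y x phi.
Proof.
  induction phi as [| | | | | | | | | |z phi IH|z phi IH]; simpl; intros H;
    try tauto; destruct (Nat.eq_dec x z); tauto.
Qed.

(** In N4 provable equivalence is not a congruence, since it says nothing about
    the negations; equivalence of both the formulas and their negations is. *)
Definition strong_equiv (phi psi : FO) : Prop :=
  provable (FImp phi psi) /\ provable (FImp psi phi) /\
  provable (FImp (FNeg phi) (FNeg psi)) /\ provable (FImp (FNeg psi) (FNeg phi)).

Lemma strong_equiv_refl phi : strong_equiv phi phi.
Proof.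
  repeat split; apply derives_none, imp_intro, derives_last.
Qed.

Lemma strong_equiv_sym phi psi : strong_equiv phi psi -> strong_equiv psi phi.
Proof. unfold strong_equiv. tauto. Qed.

Lemma provable_trans phi psi chi :
  provable (FImp phi psi) -> provable (FImp psi chi) -> provable (FImp phi chi).
Proof.
  intros H1 H2. apply derives_none, imp_intro.
  apply (by_provable _ psi); [exact H2|].
  apply (by_provable _ phi); [exact H1|apply derives_last].
Qed.

Lemma strong_equiv_trans phi psi chi :
  strong_equiv phi psi -> strong_equiv psi chi -> strong_equiv phi chi.
Proof.
  intros (? & ? & ? & ?) (? & ? & ? & ?).
  repeat split; eapply provable_trans; eassumption.
Qed.

Lemma strong_equiv_neg phi psi :
  strong_equiv phi psi -> strong_equiv (FNeg phi) (FNeg psi).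
Proof.
  intros (H1 & H2 & H3 & H4). split; [exact H3|]. split; [exact H4|].
  split; apply derives_none, imp_intro; eapply iff_backward; try apply ax_neg_neg;
    (eapply by_provable; [eassumption|]); eapply iff_forward;
    try apply ax_neg_neg; apply derives_last.
Qed.

Lemma provable_and phi phi' psi psi' :
  provable (FImp phi phi') -> provable (FImp psi psi') ->
  provable (FImp (FAnd phi psi) (FAnd phi' psi')).
Proof.
  intros H1 H2. apply derives_none, imp_intro, and_intro.
  - apply (by_provable _ phi); [exact H1|]. eapply and_left, derives_last.
  - apply (by_provable _ psi); [exact H2|]. eapply and_right, derives_last.
Qed.

Lemma provable_or phi phi' psi psi' :
  provable (FImp phi phi') -> provable (FImp psi psi') ->
  provable (FImp (FOr phi psi) (FOr phi' psi')).
Proof.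
  intros H1 H2. apply derives_none, imp_intro.
  eapply or_elim; [| |apply derives_last].
  - apply or_left, (by_provable _ phi); [exact H1|apply derives_last].
  - apply or_right, (by_provable _ psi); [exact H2|apply derives_last].
Qed.

Lemma provable_imp phi phi' psi psi' :
  provable (FImp phi' phi) -> provable (FImp psi psi') ->
  provable (FImp (FImp phi psi) (FImp phi' psi')).
Proof.
  intros H1 H2. apply derives_none, imp_intro, imp_intro.
  apply (by_provable _ psi); [exact H2|]. apply (der_mp _ phi).
  - apply (by_provable _ phi'); [exact H1|apply derives_last].
  - apply derives_weaken, derives_last.
Qed.

Lemma provable_all x phi psi :
  provable (FImp phi psi) -> provable (FImp (FAll x phi) (FAll x psi)).
Proof.
  intros H. apply (prov_gen_all x x).
  - apply substitutable_same.
  - simpl. tauto.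
  - simpl. tauto.
  - rewrite subst_same. apply (provable_trans _ phi); [|exact H].
    rewrite <- (subst_same x phi) at 2. apply prov_axiom, ax_all.
    apply substitutable_same.
Qed.

Lemma provable_ex x phi psi :
  provable (FImp phi psi) -> provable (FImp (FEx x phi) (FEx x psi)).
Proof.
  intros H. apply (prov_gen_ex x x).
  - apply substitutable_same.
  - simpl. tauto.
  - simpl. tauto.
  - rewrite subst_same. apply (provable_trans _ psi); [exact H|].
    rewrite <- (subst_same x psi) at 1. apply prov_axiom, ax_ex.
    apply substitutable_same.
Qed.

(** The axioms turn a negated connective into a positive formula over negated
    parts, so that the congruence of negated formulas reduces to the monotonicity
    of the dual connective. *)
Lemma provable_via_axioms phi phi' psi psi' :
  QN4_axiom (FIff phi phi') -> QN4_axiom (FIff psi psi') ->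
  provable (FImp phi' psi') -> provable (FImp phi psi).
Proof.
  intros H1 H2 H. apply derives_none, imp_intro.
  apply (iff_backward _ _ psi'); [exact H2|].
  apply (by_provable _ phi'); [exact H|].
  apply (iff_forward _ phi); [exact H1|apply derives_last].
Qed.

Lemma strong_equiv_and phi phi' psi psi' :
  strong_equiv phi phi' -> strong_equiv psi psi' ->
  strong_equiv (FAnd phi psi) (FAnd phi' psi').
Proof.
  intros (? & ? & ? & ?) (? & ? & ? & ?).
  repeat split; try (now apply provable_and);
    (eapply provable_via_axioms; [apply ax_neg_and|apply ax_neg_and|]);
    now apply provable_or.
Qed.

Lemma strong_equiv_or phi phi' psi psi' :
  strong_equiv phi phi' -> strong_equiv psi psi' ->
  strong_equiv (FOr phi psi) (FOr phi' psi').
Proof.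
  intros (? & ? & ? & ?) (? & ? & ? & ?).
  repeat split; try (now apply provable_or);
    (eapply provable_via_axioms; [apply ax_neg_or|apply ax_neg_or|]);
    now apply provable_and.
Qed.

Lemma strong_equiv_imp phi phi' psi psi' :
  strong_equiv phi phi' -> strong_equiv psi psi' ->
  strong_equiv (FImp phi psi) (FImp phi' psi').
Proof.
  intros (? & ? & ? & ?) (? & ? & ? & ?).
  repeat split; try (now apply provable_imp);
    (eapply provable_via_axioms; [apply ax_neg_imp|apply ax_neg_imp|]);
    now apply provable_and.
Qed.

Lemma strong_equiv_all x phi psi :
  strong_equiv phi psi -> strong_equiv (FAll x phi) (FAll x psi).
Proof.
  intros (? & ? & ? & ?).
  repeat split; try (now apply provable_all);
    (eapply provable_via_axioms; [apply ax_neg_all|apply ax_neg_all|]);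
    now apply provable_ex.
Qed.

(** The generalization rules infer the quantified formula from any one instance
    at a fresh variable, so they do the renaming in both directions. *)
Lemma strong_equiv_rename y z phi :
  substitutable z y phi -> ~ free z (FAll y phi) ->
  strong_equiv (FAll y phi) (FAll z (subst y z phi)).
Proof.
  intros Hs Hz. repeat split.
  - apply (prov_gen_all z z); [apply substitutable_same|exact Hz|simpl; tauto|].
    rewrite subst_same. now apply prov_axiom, ax_all.
  - apply (prov_gen_all y z); [exact Hs|simpl; tauto|exact Hz|].
    rewrite <- (subst_same z (subst y z phi)) at 2.
    apply prov_axiom, ax_all, substitutable_same.
  - eapply provable_via_axioms; [apply ax_neg_all|apply ax_neg_all|].
    apply (prov_gen_ex y z); [exact Hs|simpl; tauto|exact Hz|].
    rewrite <- (subst_same z (subst y z (FNeg phi))).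
    change (FNeg (subst y z phi)) with (subst y z (FNeg phi)).
    apply prov_axiom, ax_ex, substitutable_same.
  - eapply provable_via_axioms; [apply ax_neg_all|apply ax_neg_all|].
    apply (prov_gen_ex z z); [apply substitutable_same|exact Hz|simpl; tauto|].
    rewrite subst_same.
    change (FNeg (subst y z phi)) with (subst y z (FNeg phi)).
    now apply prov_axiom, ax_ex.
Qed.

(** * The box of the translation *)

(** Unlike in [std_trans], the bound variables are out of the way of all variables
    below [m], which can therefore be substituted for [u] without capture. *)
Fixpoint fresh_trans (m u : nat) (phi : MD) : FO :=
  match phi with
  | MProp n => FProp n u
  | MAnd psi chi => FAnd (fresh_trans m u psi) (fresh_trans m u chi)
  | MOr psi chi => FOr (fresh_trans m u psi) (fresh_trans m u chi)
  | MImp psi chi => FImp (fresh_trans m u psi) (fresh_trans m u chi)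
  | MNeg psi => FNeg (fresh_trans m u psi)
  | MBox psi => FAll m (FImp (FE u m) (fresh_trans (S m) m psi))
  end.

Lemma free_fresh_trans z m u phi : free z (fresh_trans m u phi) -> z = u.
Proof.
  revert m u. induction phi as [n|phi IH1 psi IH2|phi IH1 psi IH2|phi IH1 psi IH2
    |phi IH|phi IH]; simpl; intros m u H; try (destruct H as [H|H]); eauto.
  destruct H as [Hz [[H|H]|H]]; [exact H|easy|]. now apply IH in H.
Qed.

Lemma subst_fresh_trans m u v phi :
  u < m -> subst u v (fresh_trans m u phi) = fresh_trans m v phi.
Proof.
  intros Hu. induction phi as [n| | | | |phi _]; simpl; try congruence;
    unfold rename; rewrite ?Nat.eqb_refl; [reflexivity|].
  destruct (Nat.eqb_spec m u) as [->|_]; [lia|].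
  rewrite subst_not_free; [reflexivity|].
  intros H. apply free_fresh_trans in H. lia.
Qed.

Lemma substitutable_fresh_trans m u v phi :
  u < m -> v < m -> substitutable v u (fresh_trans m u phi).
Proof.
  intros Hu Hv. induction phi as [n| | | | |phi _]; simpl; auto.
  right. right. split; [lia|]. split; [exact I|].
  apply substitutable_not_free. intros H. apply free_fresh_trans in H. lia.
Qed.

Section Translation.

Variable other : nat -> nat.
Hypothesis other_neq : forall x, other x <> x.

Notation tr := (std_trans other).

Lemma free_std_trans z u phi : free z (tr u phi) -> z = u.
Proof.
  revert u. induction phi as [n|phi IH1 psi IH2|phi IH1 psi IH2|phi IH1 psi IH2
    |phi IH|phi IH]; simpl; intros u H; try (destruct H as [H|H]); eauto.
  destruct H as [Hz [[H|H]|H]]; [exact H|easy|]. now apply IH in H.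
Qed.

(** For a box, the induction hypothesis is used three times: at the variable
    that [std_trans] binds, with a bound high enough for renaming it to [m], and
    then at [m] to change that bound into the one that [fresh_trans] demands. *)
Lemma std_trans_fresh m u phi :
  u < m -> strong_equiv (tr u phi) (fresh_trans m u phi).
Proof.
  revert m u. induction phi as [n|phi IH1 psi IH2|phi IH1 psi IH2|phi IH1 psi IH2
    |phi IH|phi IH]; intros m u Hu; simpl.
  - apply strong_equiv_refl.
  - apply strong_equiv_and; auto.
  - apply strong_equiv_or; auto.
  - apply strong_equiv_imp; auto.
  - apply strong_equiv_neg; auto.
  - set (y := other u). set (k := S (m + y)).
    apply (strong_equiv_trans _ (FAll y (FImp (FE u y) (fresh_trans k y phi)))).
    + apply strong_equiv_all, strong_equiv_imp; [apply strong_equiv_refl|].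
      apply IH. lia.
    + eapply strong_equiv_trans.
      * apply (strong_equiv_rename y m).
        -- simpl. split; [exact I|]. apply substitutable_fresh_trans; lia.
        -- simpl. intros [H1 [H2|H2]]; [lia|]. apply free_fresh_trans in H2. lia.
      * simpl. rewrite subst_fresh_trans by lia. unfold rename.
        rewrite Nat.eqb_refl.
        destruct (Nat.eqb_spec u y) as [E|_]; [now destruct (other_neq u)|].
        apply strong_equiv_all, strong_equiv_imp; [apply strong_equiv_refl|].
        (* both sides are equivalent to the translation at m *)
        eapply strong_equiv_trans; [apply strong_equiv_sym, IH|apply IH]; lia.
Qed.

Definition box_body (m a : nat) (psi : MD) : FO :=
  FImp (FE a (other a)) (fresh_trans m (other a) psi).

Lemma std_trans_box m a psi :
  other a < m -> strong_equiv (tr a (MBox psi)) (FAll (other a) (box_body m a psi)).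
Proof.
  intros Hm. apply strong_equiv_all, strong_equiv_imp; [apply strong_equiv_refl|].
  now apply std_trans_fresh.
Qed.

Lemma subst_box_body m a b psi :
  other a < m -> subst (other a) b (box_body m a psi) = FImp (FE a b) (fresh_trans m b psi).
Proof.
  intros Hm. simpl. rewrite subst_fresh_trans by exact Hm. unfold rename.
  rewrite Nat.eqb_refl.
  destruct (Nat.eqb_spec a (other a)) as [E|_]; [now destruct (other_neq a)|].
  reflexivity.
Qed.

Lemma substitutable_box_body m a b psi :
  other a < m -> b < m -> substitutable b (other a) (box_body m a psi).
Proof. intros H1 H2. split; [exact I|]. now apply substitutable_fresh_trans. Qed.

Lemma free_box_body m a b psi : free b (FAll (other a) (box_body m a psi)) -> b = a.
Proof.
  simpl. intros [H1 [[H|H]|H]]; [exact H|easy|]. now apply free_fresh_trans in H.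
Qed.

Let above (a b : nat) : nat := S (a + b + other a).

(** The four rules for the box hold because [box_body] can be instantiated at
    any label [b], and [std_trans_fresh] turns the instance back into the
    translation at [b].  The label [b] may occur bound in the original
    translation. *)
Lemma box_elim Gamma a b psi :
  derives Gamma (tr a (MBox psi)) -> derives Gamma (FE a b) ->
  derives Gamma (tr b psi).
Proof.
  intros H HE. set (m := above a b).
  destruct (std_trans_box m a psi) as (B & _); [unfold m, above; lia|].
  destruct (std_trans_fresh m b psi) as (_ & F & _); [unfold m, above; lia|].
  apply (by_provable _ _ _ F). apply (der_mp _ (FE a b)); [exact HE|].
  rewrite <- subst_box_body by (unfold m, above; lia).
  apply all_elim; [apply substitutable_box_body; unfold m, above; lia|].
  now apply (by_provable _ _ _ B).
Qed.

Lemma box_intro Gamma a b psi :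
  fresh_in b Gamma -> b <> a ->
  derives (extend Gamma (FE a b)) (tr b psi) -> derives Gamma (tr a (MBox psi)).
Proof.
  intros Hb Hab H. set (m := above a b).
  destruct (std_trans_box m a psi) as (_ & B & _); [unfold m, above; lia|].
  destruct (std_trans_fresh m b psi) as (F & _); [unfold m, above; lia|].
  apply (by_provable _ _ _ B). apply (all_intro _ _ b).
  - apply substitutable_box_body; unfold m, above; lia.
  - exact Hb.
  - intros H'. now apply free_box_body in H'.
  - rewrite subst_box_body by (unfold m, above; lia).
    apply imp_intro. now apply (by_provable _ _ _ F).
Qed.

Lemma neg_box_intro Gamma a b psi :
  derives Gamma (FE a b) -> derives Gamma (FNeg (tr b psi)) ->
  derives Gamma (FNeg (tr a (MBox psi))).
Proof.
  intros HE H. set (m := above a b).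
  destruct (std_trans_box m a psi) as (_ & _ & _ & B); [unfold m, above; lia|].
  destruct (std_trans_fresh m b psi) as (_ & _ & F & _); [unfold m, above; lia|].
  apply (by_provable _ _ _ B).
  eapply iff_backward; [apply ax_neg_all|].
  apply (ex_intro_rule _ _ b);
    [apply (substitutable_box_body m a b psi); unfold m, above; lia|].
  change (subst (other a) b (FNeg ?p)) with (FNeg (subst (other a) b p)).
  rewrite subst_box_body by (unfold m, above; lia).
  eapply iff_backward; [apply ax_neg_imp|].
  apply and_intro; [exact HE|]. now apply (by_provable _ _ _ F).
Qed.

Lemma neg_box_elim Gamma a b psi delta :
  fresh_in b Gamma -> b <> a -> ~ free b delta ->
  derives (extend (extend Gamma (FE a b)) (FNeg (tr b psi))) delta ->
  derives Gamma (FNeg (tr a (MBox psi))) -> derives Gamma delta.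
Proof.
  intros Hb Hab Hd H HB. set (m := above a b).
  destruct (std_trans_box m a psi) as (_ & _ & B & _); [unfold m, above; lia|].
  destruct (std_trans_fresh m b psi) as (_ & _ & _ & F); [unfold m, above; lia|].
  apply (ex_elim _ (other a) b (FNeg (box_body m a psi))).
  - apply (substitutable_box_body m a b psi); unfold m, above; lia.
  - exact Hb.
  - exact Hd.
  - intros H'. now apply (free_box_body m a b psi) in H'.
  - change (subst (other a) b (FNeg ?p)) with (FNeg (subst (other a) b p)).
    rewrite subst_box_body by (unfold m, above; lia).
    assert (C : derives (extend Gamma (FNeg (FImp (FE a b) (fresh_trans m b psi))))
                  (FAnd (FE a b) (FNeg (fresh_trans m b psi)))).
    { eapply iff_forward; [apply ax_neg_imp|apply derives_last]. }
    apply (derives_cut _ (FE a b)); [now apply and_left in C|].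
    apply (derives_cut _ (FNeg (tr b psi))).
    + apply derives_weaken, (by_provable _ _ _ F). now apply and_right in C.
    + revert H. apply derives_mono. unfold extend. tauto.
  - eapply iff_forward; [apply ax_neg_all|]. now apply (by_provable _ _ _ B).
Qed.

End Translation.

(** * Labelled formulas and saturated theories *)

(** [At a phi] stands for the translation of [phi] at the variable [a], and
    [Edge a b] for the atom [E a b]. *)
Inductive labelled : Type :=
| At (a : nat) (phi : MD)
| Edge (a b : nat).

Definition has_label (v : nat) (l : labelled) : Prop :=
  match l with At a _ => v = a | Edge a b => v = a \/ v = b end.

Fixpoint MD_code (phi : MD) : nat :=
  match phi with
  | MProp n => to_nat (0, n)
  | MAnd psi chi => to_nat (1, to_nat (MD_code psi, MD_code chi))
  | MOr psi chi => to_nat (2, to_nat (MD_code psi, MD_code chi))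
  | MImp psi chi => to_nat (3, to_nat (MD_code psi, MD_code chi))
  | MNeg psi => to_nat (4, MD_code psi)
  | MBox psi => to_nat (5, MD_code psi)
  end.

Lemma to_nat_inj a b c d : to_nat (a, b) = to_nat (c, d) -> a = c /\ b = d.
Proof.
  intros E. apply (f_equal of_nat) in E. rewrite !cancel_of_to in E.
  now injection E.
Qed.

Lemma MD_code_inj phi psi : MD_code phi = MD_code psi -> phi = psi.
Proof.
  revert psi. induction phi; intros psi E; destruct psi; cbn [MD_code] in E;
    apply to_nat_inj in E as [E1 E2]; try discriminate E1;
    try (apply to_nat_inj in E2 as [E2 E3]); f_equal; auto.
Qed.

Definition labelled_code (l : labelled) : nat :=
  match l with
  | At a phi => to_nat (0, to_nat (a, MD_code phi))
  | Edge a b => to_nat (1, to_nat (a, b))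
  end.

Lemma labelled_code_inj l l' : labelled_code l = labelled_code l' -> l = l'.
Proof.
  destruct l, l'; cbn [labelled_code]; intros E; apply to_nat_inj in E as [E1 E2];
    try discriminate E1; apply to_nat_inj in E2 as [E2 E3]; f_equal; auto.
  now apply MD_code_inj.
Qed.

Lemma injective_avoids_list (f : nat -> nat) (l : list nat) :
  (forall i j, f i = f j -> i = j) -> exists i, ~ List.In (f i) l.
Proof.
  intros Hf. apply NNPP. intros Hno.
  assert (H : incl (map f (seq 0 (S (length l)))) l).
  { intros v Hv. apply in_map_iff in Hv as (i & <- & _).
    apply NNPP. intros Hi. apply Hno. now exists i. }
  apply NoDup_incl_length in H.
  - rewrite length_map, length_seq in H. lia.
  - apply Injective_map_NoDup; [exact Hf|apply seq_NoDup].
Qed.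

Lemma labels_finite (l : list labelled) :
  exists vs, forall chi v, List.In chi l -> has_label v chi -> List.In v vs.
Proof.
  induction l as [|chi l [vs IH]]; [now exists []|].
  destruct chi as [a phi|a b].
  - exists (a :: vs). intros chi v [<-|H] Hv; simpl in *; eauto.
  - exists (a :: b :: vs). intros chi v [<-|H] Hv; simpl in *; [intuition|eauto].
Qed.

Section Henkin.

Variable other : nat -> nat.
Hypothesis other_neq : forall x, other x <> x.

Notation tr := (std_trans other).

Definition FO_of (l : labelled) : FO :=
  match l with At a phi => tr a phi | Edge a b => FE a b end.

Definition FO_image (T : labelled -> Prop) : FO -> Prop :=
  fun gamma => exists l, T l /\ gamma = FO_of l.

Definition add (T : labelled -> Prop) (l : labelled) : labelled -> Prop :=
  fun l' => T l' \/ l' = l.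

Definition labels_in (D : nat -> Prop) (l : labelled) : Prop :=
  forall v, has_label v l -> D v.

Lemma free_FO_of v l : free v (FO_of l) -> has_label v l.
Proof. destruct l; simpl; [apply free_std_trans|auto]. Qed.

Lemma fresh_in_FO_image (T : labelled -> Prop) b :
  (forall l, T l -> ~ has_label b l) -> fresh_in b (FO_image T).
Proof. intros H gamma (l & Hl & ->) Hb. now apply free_FO_of, H in Hb. Qed.

Lemma derives_add T l phi :
  derives (FO_image (add T l)) phi <-> derives (extend (FO_image T) (FO_of l)) phi.
Proof.
  split; apply derives_mono.
  - intros gamma (l' & [H| ->] & ->); [right; now exists l'|now left].
  - intros gamma [->|(l' & H & ->)]; [exists l|exists l']; unfold add; auto.
Qed.

Lemma derives_chain (T : nat -> labelled -> Prop) phi :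
  (forall m n l, m <= n -> T m l -> T n l) ->
  derives (FO_image (fun l => exists n, T n l)) phi ->
  exists n, derives (FO_image (T n)) phi.
Proof.
  intros Hmono. induction 1 as [phi (l & (n & Hn) & ->)|phi H|phi psi _ [n IH1] _ [m IH2]].
  - exists n. apply der_hyp. now exists l.
  - exists 0. now apply der_provable.
  - exists (n + m). apply (der_mp _ phi); [revert IH1|revert IH2];
      apply derives_mono; intros gamma (l & H & ->); exists l; (split; [|reflexivity]);
      (eapply Hmono; [|exact H]); lia.
Qed.

(** [D] holds the labels in use.  Infinitely many labels stay out of [D], so that
    a saturated theory can be extended to another one with new witnesses. *)
Record saturated (T : labelled -> Prop) (D : nat -> Prop) : Prop := {
  sat_labels : forall l, T l -> labels_in D l;
  sat_closed : forall l, labels_in D l -> derives (FO_image T) (FO_of l) -> T l;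
  sat_prime : forall a phi psi, T (At a (MOr phi psi)) ->
    T (At a phi) \/ T (At a psi);
  sat_witness : forall a psi, T (At a (MNeg (MBox psi))) ->
    exists b, T (Edge a b) /\ T (At b (MNeg psi));
  sat_reserve : exists res : nat -> nat,
    (forall i j, res i = res j -> i = j) /\ (forall i, ~ D (res i))
}.

Section Lindenbaum.

Variable T0 : labelled -> Prop.
Variable D0 : nat -> Prop.
Variable Delta : FO -> Prop.
Variable res : nat -> nat.
Hypothesis T0_labels : forall l, T0 l -> labels_in D0 l.
Hypothesis Delta_labels : forall delta, Delta delta -> forall v, free v delta -> D0 v.
Hypothesis Delta_directed : forall d1 d2, Delta d1 -> Delta d2 ->
  exists d, Delta d /\ provable (FImp d1 d) /\ provable (FImp d2 d).
Hypothesis res_inj : forall i j, res i = res j -> i = j.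
Hypothesis res_new : forall i, ~ D0 (res i).

Let avoids (T : labelled -> Prop) : Prop :=
  forall delta, Delta delta -> ~ derives (FO_image T) delta.

Hypothesis T0_avoids : avoids T0.

(** The labels of even rank in the reserve are spent on witnesses; those of odd
    rank remain as the reserve of the result. *)
Let D : nat -> Prop := fun v => forall i, v <> res (2 * i + 1).

Let plus (l : list labelled) : labelled -> Prop := fun chi => T0 chi \/ List.In chi l.

Let good (l : list labelled) : Prop :=
  (forall chi, List.In chi l -> labels_in D chi) /\ avoids (plus l).

Let handled (chi : labelled) (l l' : list labelled) : Prop :=
  ~ labels_in D chi \/ ~ avoids (add (plus l) chi) \/
  (List.In chi l' /\ forall a psi, chi = At a (MNeg (MBox psi)) ->
     exists b, List.In (Edge a b) l' /\ List.In (At b (MNeg psi)) l').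

Lemma D0_sub_D v : D0 v -> D v.
Proof. intros H i ->. now apply res_new in H. Qed.

Lemma avoids_mono (T T' : labelled -> Prop) :
  (forall l, T l -> T' l) -> avoids T' -> avoids T.
Proof.
  intros Hsub H delta Hd Hder. apply (H delta Hd). revert Hder.
  apply derives_mono. intros gamma (l & Hl & ->). exists l. auto.
Qed.

Lemma witness_exists (l : list labelled) :
  exists b, D b /\ ~ D0 b /\ forall chi, List.In chi l -> ~ has_label b chi.
Proof.
  destruct (labels_finite l) as [vs Hvs].
  destruct (injective_avoids_list (fun i => res (2 * i)) vs) as [i Hi].
  { intros i j E. apply res_inj in E. lia. }
  exists (res (2 * i)). split; [|split].
  - intros j E. apply res_inj in E. lia.
  - apply res_new.
  - intros chi Hchi Hb. apply Hi. eauto.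
Qed.

(** A labelled formula over [D] is added if this keeps [Delta] underivable, and
    a negated box is added along with a witness.  One that is not added makes
    some member of [Delta] derivable, now and at all later stages. *)
Lemma lindenbaum_step chi l :
  good l -> exists l', good l' /\ incl l l' /\ handled chi l l'.
Proof.
  intros [HD Hav].
  destruct (classic (labels_in D chi)) as [Hchi|Hchi];
    [|exists l; split; [now split|split; [apply incl_refl|now left]]].
  destruct (classic (avoids (add (plus l) chi))) as [Hadd|Hadd];
    [|exists l; split; [now split|split; [apply incl_refl|now right; left]]].
  assert (Hcons : good (chi :: l)).
  { split; [intros chi' [<-|H]; auto|].
    revert Hadd. apply avoids_mono. unfold plus, add. simpl. intuition. }
  destruct (classic (exists a psi, chi = At a (MNeg (MBox psi))))
    as [(a & psi & ->)|Hnot].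
  - destruct (witness_exists (At a (MNeg (MBox psi)) :: l)) as (b & HDb & HD0b & Hb).
    exists (At b (MNeg psi) :: Edge a b :: At a (MNeg (MBox psi)) :: l).
    split; [split|split].
    + intros chi' [<-|[<-|H]].
      * intros v Hv. simpl in Hv. now subst.
      * intros v [->| ->]; [apply Hchi; reflexivity|exact HDb].
      * now apply Hcons.
    (* a derivation from the witness would give one from the negated box *)
    + intros delta Hd H.
      set (T1 := plus (At a (MNeg (MBox psi)) :: l)).
      apply (proj2 Hcons delta Hd).
      apply (neg_box_elim other other_neq (FO_image T1) a b psi).
      * apply fresh_in_FO_image. intros chi' [H'|H'] Hlab; [|now apply (Hb chi')].
        now apply HD0b, (T0_labels chi').
      * intros ->. apply (Hb _ (or_introl eq_refl)). reflexivity.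
      * intros Hfree. now apply HD0b, (Delta_labels delta).
      * revert H. apply derives_mono. intros gamma (chi' & [H|[<-|[<-|H]]] & ->).
        -- right. right. exists chi'. split; [now left|reflexivity].
        -- now left.
        -- right. now left.
        -- right. right. exists chi'. split; [now right|reflexivity].
      * apply der_hyp. exists (At a (MNeg (MBox psi))).
        split; [right; now left|reflexivity].
    + do 3 apply incl_tl. apply incl_refl.
    + right. right. split; [simpl; auto|]. intros a' psi' E. injection E as <- <-.
      exists b. simpl. auto.
  - exists (chi :: l). split; [exact Hcons|split; [apply incl_tl, incl_refl|]].
    right. right. split; [now left|]. intros a psi ->. destruct Hnot. now exists a, psi.
Qed.

(** Exhausting all labelled formulas yields a theory in which every absent formula
    over [D] would make a member of [Delta] derivable; closure and primeness
    follow from this, the latter because [Delta] is directed. *)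
Lemma lindenbaum :
  exists T D', saturated T D' /\ (forall l, T0 l -> T l) /\
    (forall v, D0 v -> D' v) /\ avoids T.
Proof.
  assert (Hgood0 : good []).
  { split; [easy|]. revert T0_avoids. apply avoids_mono. intros l [H|[]]. exact H. }
  (* the formula with code n, if there is one, is handled at stage n *)
  set (next n (s : {l | good l}) (s' : {l | good l}) :=
    incl (proj1_sig s) (proj1_sig s') /\
    forall chi, labelled_code chi = n -> handled chi (proj1_sig s) (proj1_sig s')).
  assert (Hnext : forall n s, exists s', next n s s').
  { intros n [l Hl].
    destruct (classic (exists chi, labelled_code chi = n)) as [[chi <-]|Hno].
    - destruct (lindenbaum_step chi l Hl) as (l' & Hl' & Hincl & Hh).
      exists (exist _ l' Hl'). split; [exact Hincl|].
      intros chi' E. apply labelled_code_inj in E as ->. exact Hh.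
    - exists (exist _ l Hl). split; [apply incl_refl|].
      intros chi E. destruct Hno. now exists chi. }
  set (stage := fix stage n := match n with
    | 0 => exist _ [] Hgood0
    | S n => proj1_sig (constructive_indefinite_description _ (Hnext n (stage n)))
    end).
  assert (Hstage : forall n, next n (stage n) (stage (S n))).
  { intros n. exact (proj2_sig (constructive_indefinite_description _ _)). }
  clearbody stage.
  assert (Hincl : forall m n, m <= n ->
    incl (proj1_sig (stage m)) (proj1_sig (stage n))).
  { induction 1 as [|n _ IH]; [apply incl_refl|].
    apply (incl_tran IH), Hstage. }
  set (T := fun l => exists n, plus (proj1_sig (stage n)) l).
  assert (HTn : forall n l, plus (proj1_sig (stage n)) l -> T l)
    by (intros n l H; now exists n).
  assert (HT0 : forall l, T0 l -> T l) by (intros l H; exists 0; now left).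
  assert (HTD : forall l, T l -> labels_in D l).
  { intros l (n & [H|H]).
    - intros v Hv. now apply D0_sub_D, (T0_labels l).
    - now apply (proj2_sig (stage n)). }
  assert (HTav : avoids T).
  { intros delta Hd H. apply derives_chain in H as [n H].
    - now apply (proj2 (proj2_sig (stage n)) delta).
    - intros m n l Hle [H'|H']; [now left|]. right. now apply (Hincl m n Hle). }
  assert (Hmax : forall chi, labels_in D chi -> avoids (add T chi) ->
    T chi /\ forall a psi, chi = At a (MNeg (MBox psi)) ->
      exists b, T (Edge a b) /\ T (At b (MNeg psi))).
  { intros chi HDchi Hav.
    destruct (Hstage (labelled_code chi)) as [_ Hh].
    destruct (Hh chi eq_refl) as [H|[H|[H1 H2]]].
    - contradiction.
    - destruct H. revert Hav. apply avoids_mono. intros l [H| ->]; [left; eauto|now right].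
    - split; [eapply HTn; now right; exact H1|].
      intros a psi E. destruct (H2 a psi E) as (b & Hb1 & Hb2).
      exists b. split; eapply HTn; right; eassumption. }
  assert (Hclosed : forall l, labels_in D l -> derives (FO_image T) (FO_of l) -> T l).
  { intros l Hl Hder. apply Hmax; [exact Hl|].
    intros delta Hd H. apply (HTav delta Hd).
    apply (derives_cut _ (FO_of l)); [exact Hder|]. now apply derives_add. }
  exists T, D. split; [|split; [exact HT0|split; [exact D0_sub_D|exact HTav]]].
  split.
  - exact HTD.
  - exact Hclosed.
  - intros a phi psi Hor. apply NNPP. intros Hno.
    assert (HDa : forall chi, labels_in D (At a chi)).
    { intros chi v Hv. now apply (HTD _ Hor). }
    assert (Hout : forall chi, ~ T (At a chi) ->
      exists d, Delta d /\ derives (FO_image (add T (At a chi))) d).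
    { intros chi Hchi. apply NNPP. intros Hnd. apply Hchi, Hmax; [apply HDa|].
      intros d Hd H. apply Hnd. now exists d. }
    destruct (Hout phi) as (d1 & Hd1 & H1); [tauto|].
    destruct (Hout psi) as (d2 & Hd2 & H2); [tauto|].
    destruct (Delta_directed d1 d2 Hd1 Hd2) as (d & Hd & P1 & P2).
    apply (HTav d Hd). apply (or_elim _ (tr a phi) (tr a psi)).
    + apply (by_provable _ _ _ P1). now apply derives_add in H1.
    + apply (by_provable _ _ _ P2). now apply derives_add in H2.
    + apply der_hyp. now exists (At a (MOr phi psi)).
  - intros a psi H. apply (Hmax (At a (MNeg (MBox psi)))); [now apply HTD| |reflexivity].
    revert HTav. apply avoids_mono. intros l [Hl| ->]; assumption.
  - exists (fun i => res (2 * i + 1)). split.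
    + intros i j E. apply res_inj in E. lia.
    + intros i Hi. now apply (Hi i).
Qed.

End Lindenbaum.

(** * The canonical model *)

Record point : Type := {
  theory : labelled -> Prop;
  domain : nat -> Prop;
  theory_saturated : saturated theory domain;
  label : nat;
  label_domain : domain label
}.

Definition canonical_le (p q : point) : Prop :=
  label p = label q /\ (forall l, theory p l -> theory q l).

(** The points over one theory are the elements of one first-order world. *)
Definition canonical_acc (p q : point) : Prop :=
  (forall l, theory p l <-> theory q l) /\ theory p (Edge (label p) (label q)).

Definition at_label (p : point) (a : nat) (H : domain p a) : point :=
  {| theory := theory p; domain := domain p;
     theory_saturated := theory_saturated p; label := a; label_domain := H |}.

Lemma edge_domain p a b : theory p (Edge a b) -> domain p a /\ domain p b.
Proof.
  intros H. pose proof (sat_labels _ _ (theory_saturated p) _ H) as HD.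
  split; apply HD; simpl; auto.
Qed.

Lemma canonical_le_preorder : PreOrder canonical_le.
Proof.
  split; [now intros p|]. intros p q r [E1 H1] [E2 H2].
  split; [congruence|auto].
Qed.

Lemma canonical_V_up (f : nat -> nat -> labelled) (n : nat) (p q : point) :
  canonical_le p q -> theory p (f n (label p)) -> theory q (f n (label q)).
Proof. intros [E H] Hp. rewrite <- E. auto. Qed.

Lemma canonical_acc_forth p p' q : canonical_le p p' -> canonical_acc p q ->
  exists q', canonical_acc p' q' /\ canonical_le q q'.
Proof.
  intros [E H] [HT Hpq]. apply H in Hpq.
  exists (at_label p' (label q) (proj2 (edge_domain _ _ _ Hpq))).
  split; split; simpl; try easy.
  - now rewrite <- E.
  - intros l Hl. now apply H, HT.
Qed.

Lemma canonical_acc_back p q q' : canonical_acc p q -> canonical_le q q' ->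
  exists p', canonical_le p p' /\ canonical_acc p' q'.
Proof.
  intros [HT Hpq] [E H]. apply HT, H in Hpq.
  exists (at_label q' (label p) (proj1 (edge_domain _ _ _ Hpq))).
  split; split; simpl; try easy.
  - intros l Hl. now apply H, HT.
  - now rewrite <- E.
Qed.

Definition canonical_model (p : point) : fsk_model := {|
  world := point;
  world_inhabited := inhabits p;
  le := canonical_le;
  le_preorder := canonical_le_preorder;
  acc := canonical_acc;
  Vpos n q := theory q (At (label q) (MProp n));
  Vneg n q := theory q (At (label q) (MNeg (MProp n)));
  Vpos_up := canonical_V_up (fun n a => At a (MProp n));
  Vneg_up := canonical_V_up (fun n a => At a (MNeg (MProp n)));
  acc_forth := canonical_acc_forth;
  acc_back := canonical_acc_back
|}.

Lemma theory_closed p phi :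
  derives (FO_image (theory p)) (tr (label p) phi) -> theory p (At (label p) phi).
Proof.
  intros H. apply (sat_closed _ _ (theory_saturated p) (At (label p) phi)).
  - intros v ->. apply label_domain.
  - exact H.
Qed.

Lemma theory_derives p l : theory p l -> derives (FO_image (theory p)) (FO_of l).
Proof. intros H. apply der_hyp. now exists l. Qed.

Lemma point_extension p D0 l delta res :
  (forall v, domain p v -> D0 v) -> labels_in D0 l ->
  (forall v, free v delta -> D0 v) ->
  (forall i j, res i = res j -> i = j) -> (forall i : nat, ~ D0 (res i)) ->
  ~ derives (FO_image (add (theory p) l)) delta ->
  exists T D, saturated T D /\ (forall v, D0 v -> D v) /\
    (forall l, theory p l -> T l) /\ T l /\ ~ derives (FO_image T) delta.
Proof.
  intros HD Hl Hdelta Hinj Hnew Hav.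
  destruct (lindenbaum (add (theory p) l) D0 (eq delta) res)
    as (T & D & HTD & Hsub & HDD & HT); auto.
  - intros l' [H| ->]; [|exact Hl]. intros v Hv.
    apply HD. now apply (sat_labels _ _ (theory_saturated p) l').
  - intros d <-. exact Hdelta.
  - intros d1 d2 <- <-. exists delta. split; [reflexivity|].
    split; apply derives_none, imp_intro, derives_last.
  - intros d <-. exact Hav.
  - exists T, D. split; [exact HTD|]. split; [exact HDD|].
    split; [intros l' H; apply Hsub; now left|].
    split; [apply Hsub; now right|]. now apply HT.
Qed.

(** If the implication is absent, adding its antecedent leaves its consequent
    underivable, by the deduction theorem. *)
Lemma theory_imp_iff p phi psi :
  theory p (At (label p) (MImp phi psi)) <->
  forall q, canonical_le p q ->
    theory q (At (label q) phi) -> theory q (At (label q) psi).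
Proof.
  split.
  - intros H q [E Hsub] Hphi. apply Hsub in H. rewrite E in H.
    apply theory_derives in H, Hphi. apply theory_closed.
    now apply (der_mp _ (tr (label q) phi)).
  - intros H. apply NNPP. intros Hno.
    destruct (sat_reserve _ _ (theory_saturated p)) as (res & Hinj & Hnew).
    destruct (point_extension p (domain p) (At (label p) phi) (tr (label p) psi) res)
      as (T & D & HTD & HD & Hsub & HT & Hpsi); auto.
    + intros v ->. apply label_domain.
    + intros v Hv. apply free_std_trans in Hv as ->. apply label_domain.
    + intros Hder. apply Hno, theory_closed. apply imp_intro.
      now apply derives_add in Hder.
    + apply Hpsi.
      set (q := {| theory := T; domain := D; theory_saturated := HTD;
                   label := label p; label_domain := HD _ (label_domain p) |}).
      apply (theory_derives q (At (label p) psi)). apply (H q); [now split|exact HT].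
Qed.

(** If the box is absent, a new edge to a label from the reserve leaves the formula
    underivable there, by [box_intro]. *)
Lemma theory_box_iff p psi :
  theory p (At (label p) (MBox psi)) <->
  forall q r, canonical_le p q -> canonical_acc q r -> theory r (At (label r) psi).
Proof.
  split.
  - intros H q r [E Hsub] [HT Hqr]. apply theory_closed.
    apply HT in Hqr. apply Hsub, HT in H. rewrite E in H.
    apply (box_elim other other_neq _ (label q)); now apply theory_derives in H, Hqr.
  - intros H. apply NNPP. intros Hno.
    destruct (sat_reserve _ _ (theory_saturated p)) as (res & Hinj & Hnew).
    set (b := res 0).
    assert (Hb : b <> label p).
    { intros E. apply (Hnew 0). fold b. rewrite E. apply label_domain. }
    destruct (point_extension p (fun v => domain p v \/ v = b) (Edge (label p) b)
                (tr b psi) (fun i => res (S i)))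
      as (T & D & HTD & HD & Hsub & HT & Hpsi).
    + now left.
    + intros v [->| ->]; [left; apply label_domain|now right].
    + intros v Hv. apply free_std_trans in Hv as ->. now right.
    + intros i j E. apply Hinj in E. lia.
    + intros i [H'|H']; [now apply Hnew in H'|]. apply Hinj in H'. lia.
    + intros Hder. apply Hno, theory_closed.
      apply (box_intro other other_neq _ _ b); [|exact Hb|now apply derives_add in Hder].
      apply fresh_in_FO_image. intros l Hl Hlb. apply (Hnew 0).
      now apply (sat_labels _ _ (theory_saturated p) l Hl).
    + set (q := {| theory := T; domain := D; theory_saturated := HTD;
                   label := label p;
                   label_domain := HD _ (or_introl (label_domain p)) |}).
      set (r := at_label q b (HD b (or_intror eq_refl))).
      apply Hpsi, (theory_derives r (At b psi)). apply (H q r); now split.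
Qed.

Lemma theory_neg_box_iff p psi :
  theory p (At (label p) (MNeg (MBox psi))) <->
  exists q, canonical_acc p q /\ theory q (At (label q) (MNeg psi)).
Proof.
  split.
  - intros H. apply (sat_witness _ _ (theory_saturated p)) in H as (b & HE & Hb).
    exists (at_label p b (proj2 (edge_domain _ _ _ HE))). now split.
  - intros (q & [HT HE] & Hq). apply HT in Hq. apply theory_closed.
    apply (neg_box_intro other other_neq _ _ (label q));
      now apply theory_derives in HE, Hq.
Qed.

Lemma theory_iff p phi psi :
  QN4_axiom (FIff (tr (label p) phi) (tr (label p) psi)) ->
  theory p (At (label p) phi) <-> theory p (At (label p) psi).
Proof.
  intros H. split; intros Hp; apply theory_derives in Hp; apply theory_closed.
  - now apply (iff_forward _ _ _ H).
  - now apply (iff_backward _ _ _ H).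
Qed.

Lemma theory_and_iff p phi psi :
  theory p (At (label p) (MAnd phi psi)) <->
  theory p (At (label p) phi) /\ theory p (At (label p) psi).
Proof.
  split.
  - intros H. apply theory_derives in H.
    split; apply theory_closed; [eapply and_left|eapply and_right]; exact H.
  - intros [H1 H2]. apply theory_derives in H1, H2.
    apply theory_closed. now apply and_intro.
Qed.

Lemma theory_or_iff p phi psi :
  theory p (At (label p) (MOr phi psi)) <->
  theory p (At (label p) phi) \/ theory p (At (label p) psi).
Proof.
  split.
  - apply (sat_prime _ _ (theory_saturated p)).
  - intros [H|H]; apply theory_derives in H; apply theory_closed;
      [now apply or_left|now apply or_right].
Qed.

Lemma truth_lemma o phi (p : point) :
  (sat_pos (canonical_model o) p phi <-> theory p (At (label p) phi)) /\
  (sat_neg (canonical_model o) p phi <-> theory p (At (label p) (MNeg phi))).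
Proof.
  revert p. induction phi as [n|phi IH1 psi IH2|phi IH1 psi IH2|phi IH1 psi IH2
    |phi IH|phi IH]; intros p; simpl.
  - tauto.
  - rewrite theory_and_iff, (theory_iff p (MNeg (MAnd phi psi)) (MOr (MNeg phi) (MNeg psi))),
      theory_or_iff by apply ax_neg_and.
    destruct (IH1 p), (IH2 p). tauto.
  - rewrite theory_or_iff, (theory_iff p (MNeg (MOr phi psi)) (MAnd (MNeg phi) (MNeg psi))),
      theory_and_iff by apply ax_neg_or.
    destruct (IH1 p), (IH2 p). tauto.
  - rewrite theory_imp_iff, (theory_iff p (MNeg (MImp phi psi)) (MAnd phi (MNeg psi))),
      theory_and_iff by apply ax_neg_imp.
    destruct (IH1 p), (IH2 p). split; [|tauto].
    split; intros Himp q Hq Hphi; apply IH2, (Himp q Hq), IH1, Hphi.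
  - rewrite (theory_iff p (MNeg (MNeg phi)) phi) by apply ax_neg_neg.
    destruct (IH p). tauto.
  - rewrite theory_box_iff, theory_neg_box_iff. split.
    + split; intros H q r Hq Hr; apply IH, (H q r Hq Hr).
    + split; intros (q & Hq & H); exists q; (split; [exact Hq|]); now apply IH.
Qed.

Lemma fold_or_first theta thetas :
  provable (FImp theta (fold_left FOr thetas theta)).
Proof.
  revert theta. induction thetas as [|t l IH]; intros theta; simpl.
  - apply derives_none, imp_intro, derives_last.
  - eapply provable_trans; [|apply IH]. apply prov_axiom, ax_or_l.
Qed.

Lemma fold_or_mono theta theta' thetas :
  provable (FImp theta theta') ->
  provable (FImp (fold_left FOr thetas theta) (fold_left FOr thetas theta')).
Proof.
  revert theta theta'. induction thetas as [|t l IH]; intros theta theta' H; simpl.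
  - exact H.
  - apply IH, provable_or; [exact H|]. apply derives_none, imp_intro, derives_last.
Qed.

Lemma free_fold_or v theta thetas :
  free v (fold_left FOr thetas theta) ->
  exists t, List.In t (theta :: thetas) /\ free v t.
Proof.
  revert theta. induction thetas as [|t l IH]; intros theta; simpl.
  - intros H. exists theta. auto.
  - intros H. apply IH in H as (t' & [<-|Hin] & Hf).
    + destruct Hf; eauto.
    + eauto.
Qed.

(** Finite disjunctions of translations from [Delta] form a directed set, which
    is what [lindenbaum] has to keep underivable. *)
Lemma FSKd_to_QN4 (Gamma Delta : Ensemble MD) x :
  FSKd_conseq Gamma Delta -> QN4_conseq (Im MD FO Gamma (tr x)) (Im MD FO Delta (tr x)).
Proof.
  intros Hconseq. apply QN4_conseq_iff. apply NNPP. intros Hno. apply Hconseq.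
  set (ImD := Im MD FO Delta (tr x)).
  set (Disj := fun d => exists theta thetas,
    In FO ImD theta /\ Forall (In FO ImD) thetas /\ d = fold_left FOr thetas theta).
  destruct (lindenbaum (fun l => exists phi, In MD Gamma phi /\ l = At x phi)
              (eq x) Disj (fun i => S (x + i))) as (T & D & HTD & Hsub & HD & HT).
  - intros l (phi & _ & ->) v Hv. simpl in Hv. congruence.
  - intros d (theta & thetas & H & Hs & ->) v Hv.
    apply free_fold_or in Hv as (t & Ht & Hv).
    assert (H' : In FO ImD t).
    { rewrite Forall_forall in Hs. destruct Ht as [<-|Ht]; auto. }
    destruct H' as [psi _ t ->]. apply free_std_trans in Hv. congruence.
  - intros d1 d2 (t1 & l1 & H1 & Hl1 & ->) (t2 & l2 & H2 & Hl2 & ->).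
    exists (fold_left FOr (l1 ++ t2 :: l2) t1). split; [|split].
    + exists t1, (l1 ++ t2 :: l2). split; [exact H1|]. split; [|reflexivity].
      apply Forall_app. auto.
    + rewrite fold_left_app. simpl.
      eapply provable_trans; [|apply fold_or_first]. apply prov_axiom, ax_or_l.
    + rewrite fold_left_app. simpl. apply fold_or_mono, prov_axiom, ax_or_r.
  - intros i j E. lia.
  - intros i E. lia.
  - intros d (theta & thetas & H & Hs & ->) Hd. apply Hno.
    exists theta, thetas. split; [exact H|]. split; [exact Hs|].
    revert Hd. apply derives_mono. intros gamma (l & (phi & Hphi & ->) & ->).
    now exists phi.
  - set (p := {| theory := T; domain := D; theory_saturated := HTD;
                 label := x; label_domain := HD x eq_refl |}).
    exists (canonical_model p), p. split.
    + intros phi Hphi. apply truth_lemma. simpl. apply Hsub. now exists phi.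
    + intros psi Hpsi H. apply truth_lemma in H. apply (HT (tr x psi)).
      * exists (tr x psi), []. split; [now exists psi|]. now split.
      * exact (theory_derives p _ H).
Qed.

End Henkin.

(** * Kripke models with constant domains *)

Inductive symbol : Type := Sprop (n : nat) | Sset | Sobj | Sedge | Srel | Sequal.

(** The boolean tells the extension of a predicate from that of its negation: in
    N4 these are independent of each other. *)
Record kripke : Type := {
  stage : Type;
  stage_le : stage -> stage -> Prop;
  stage_refl : forall k, stage_le k k;
  stage_trans : forall k1 k2 k3,
    stage_le k1 k2 -> stage_le k2 k3 -> stage_le k1 k3;
  individual : Type;
  extension : bool -> symbol -> list individual -> stage -> Prop;
  extension_up : forall s Q ds k k',
    stage_le k k' -> extension s Q ds k -> extension s Q ds k'
}.

Definition update {A : Type} (e : nat -> A) (x : nat) (d : A) : nat -> A :=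
  fun z => if Nat.eqb z x then d else e z.

Section Forcing.

Variable K : kripke.

Fixpoint force (s : bool) (k : stage K) (e : nat -> individual K) (phi : FO) : Prop :=
  match phi with
  | FProp n a => extension K s (Sprop n) [e a] k
  | FS a => extension K s Sset [e a] k
  | FOb a => extension K s Sobj [e a] k
  | FE a b => extension K s Sedge [e a; e b] k
  | FR a b c => extension K s Srel [e a; e b; e c] k
  | FEq a b => if s then e a = e b else extension K false Sequal [e a; e b] k
  | FAnd psi chi =>
      if s then force true k e psi /\ force true k e chi
      else force false k e psi \/ force false k e chi
  | FOr psi chi =>
      if s then force true k e psi \/ force true k e chi
      else force false k e psi /\ force false k e chi
  | FImp psi chi =>
      if s then forall k', stage_le K k k' -> force true k' e psi -> force true k' e chi
      else force true k e psi /\ force false k e chi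
  | FNeg psi => force (negb s) k e psi
  | FAll z psi =>
      if s then forall d, force true k (update e z d) psi
      else exists d, force false k (update e z d) psi
  | FEx z psi =>
      if s then exists d, force true k (update e z d) psi
      else forall d, force false k (update e z d) psi
  end.

Lemma force_up phi : forall s k k' e,
  stage_le K k k' -> force s k e phi -> force s k' e phi.
Proof.
  induction phi as [n a|a|a|a b|a b c|a b|phi IH1 psi IH2|phi IH1 psi IH2
    |phi IH1 psi IH2|phi IH|z phi IH|z phi IH]; intros s k k' e Hk; simpl;
    try (now apply extension_up).
  - destruct s; [easy|now apply extension_up].
  - destruct s; intros [H1|H1] || intros [H1 H2]; eauto.
  - destruct s; intros [H1|H1] || intros [H1 H2]; eauto.
  - destruct s.
    + intros H k2 Hk2. apply H. now apply (stage_trans K _ k').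
    + intros [H1 H2]. eauto.
  - now apply IH.
  - destruct s; [intros H d|intros [d H]; exists d]; eauto.
  - destruct s; [intros [d H]; exists d|intros H d]; eauto.
Qed.

Lemma force_agree phi : forall s k e e',
  (forall z, free z phi -> e z = e' z) -> force s k e phi <-> force s k e' phi.
Proof.
  induction phi as [n a|a|a|a b|a b c|a b|phi IH1 psi IH2|phi IH1 psi IH2
    |phi IH1 psi IH2|phi IH|z phi IH|z phi IH]; intros s k e e' He; simpl in *;
    try (rewrite !He by auto; reflexivity).
  - destruct s; rewrite (IH1 _ k e e'), (IH2 _ k e e') by auto; reflexivity.
  - destruct s; rewrite (IH1 _ k e e'), (IH2 _ k e e') by auto; reflexivity.
  - destruct s.
    + split; intros H k' Hk; specialize (H k' Hk);
        rewrite (IH1 true k' e e'), (IH2 true k' e e') in * by auto; exact H.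
    + rewrite (IH1 true k e e'), (IH2 false k e e') by auto. reflexivity.
  - now apply IH.
  - assert (Hd : forall s d, force s k (update e z d) phi <-> force s k (update e' z d) phi).
    { intros s' d. apply IH. intros v Hv. unfold update.
      destruct (Nat.eqb_spec v z); auto. }
    destruct s; setoid_rewrite Hd; reflexivity.
  - assert (Hd : forall s d, force s k (update e z d) phi <-> force s k (update e' z d) phi).
    { intros s' d. apply IH. intros v Hv. unfold update.
      destruct (Nat.eqb_spec v z); auto. }
    destruct s; setoid_rewrite Hd; reflexivity.
Qed.

Lemma force_update_fresh s k e x d phi :
  ~ free x phi -> force s k (update e x d) phi <-> force s k e phi.
Proof.
  intros Hx. apply force_agree. intros z Hz. unfold update.
  destruct (Nat.eqb_spec z x); [congruence|reflexivity].
Qed.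

Lemma force_subst x y phi : forall s k e,
  substitutable y x phi ->
  force s k e (subst x y phi) <-> force s k (update e x (e y)) phi.
Proof.
  assert (R : forall (e : nat -> individual K) a,
    e (rename x y a) = update e x (e y) a).
  { intros e a. unfold rename, update. now destruct (Nat.eqb a x). }
  (* under a binder z, the two updates commute *)
  assert (Q : forall z psi,
    (forall s k e, substitutable y x psi ->
       force s k e (subst x y psi) <-> force s k (update e x (e y)) psi) ->
    x = z \/ ~ free x psi \/ y <> z /\ substitutable y x psi ->
    forall s k e d,
      force s k (update e z d) (if Nat.eqb z x then psi else subst x y psi) <->
      force s k (update (update e x (e y)) z d) psi).
  { intros z psi IH Hs s k e d. destruct (Nat.eqb_spec z x) as [->|Hzx].
    - apply force_agree. intros v _. unfold update. now destruct (Nat.eqb v x).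
    - destruct Hs as [Hs|[Hs|[Hyz Hs]]]; [congruence| |].
      + rewrite subst_not_free by exact Hs. apply force_agree. intros v Hv.
        unfold update. destruct (Nat.eqb v z); [reflexivity|].
        destruct (Nat.eqb_spec v x); [congruence|reflexivity].
      + rewrite (IH s k (update e z d) Hs). apply force_agree. intros v Hv.
        unfold update. destruct (Nat.eqb_spec v x), (Nat.eqb_spec v z); try congruence.
        destruct (Nat.eqb_spec y z); congruence. }
  induction phi as [n a|a|a|a b|a b c|a b|phi IH1 psi IH2|phi IH1 psi IH2
    |phi IH1 psi IH2|phi IH|z phi IH|z phi IH]; intros s k e Hs; simpl;
    try (rewrite !R; reflexivity).
  - destruct Hs as [H1 H2], s; rewrite ?IH1, ?IH2 by assumption; reflexivity.
  - destruct Hs as [H1 H2], s; rewrite ?IH1, ?IH2 by assumption; reflexivity.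
  - destruct Hs as [H1 H2], s.
    + split; intros H k' Hk; specialize (H k' Hk);
        rewrite IH1, IH2 in * by assumption; exact H.
    + rewrite IH1, IH2 by assumption; reflexivity.
  - now apply IH.
  - destruct s; setoid_rewrite (Q z phi IH Hs); reflexivity.
  - destruct s; setoid_rewrite (Q z phi IH Hs); reflexivity.
Qed.

Lemma force_iff k e phi psi :
  (forall k', force true k' e phi <-> force true k' e psi) ->
  force true k e (FIff phi psi).
Proof. intros H. split; intros k' _; apply H. Qed.

Lemma axiom_sound phi : QN4_axiom phi -> forall k e, force true k e phi.
Proof.
  destruct 1 as [phi psi|phi psi chi|phi psi|phi psi|phi psi|phi psi|phi psi
    |phi psi chi|x y phi Hs|x y phi Hs|x|x y z phi Hy Hz|phi|phi psi|phi psi|phi psi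
    |x phi|x phi]; intros k e; try (apply force_iff; intros k'; simpl; tauto).
  - intros k1 H1 Hphi k2 H2 _. now apply (force_up _ _ k1).
  - intros k1 H1 Hc k2 H2 Hp k3 H3 Hphi.
    apply (Hc k3); [now apply (stage_trans K _ k2)|exact Hphi|apply stage_refl|].
    now apply Hp.
  - intros k1 _ H. apply H.
  - intros k1 _ H. apply H.
  - intros k1 _ H k2 H2 H'. split; [now apply (force_up _ _ k1)|exact H'].
  - intros k1 _ H. now left.
  - intros k1 _ H. now right.
  - intros k1 H1 Hp k2 H2 Hq k3 H3 [H|H]; [|now apply Hq].
    apply Hp; [now apply (stage_trans K _ k2)|exact H].
  - intros k1 _ H. apply force_subst; [exact Hs|]. apply H.
  - intros k1 _ H. apply force_subst in H; [|exact Hs]. now exists (e y).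
  - reflexivity.
  - intros k1 _ E k2 _ H. apply force_subst in H; [|exact Hy].
    apply force_subst; [exact Hz|]. simpl in E. now rewrite <- E.
Qed.

Lemma provable_sound phi : provable phi -> forall k e, force true k e phi.
Proof.
  induction 1 as [phi H|phi psi _ IH1 _ IH2|x y phi psi Hs Hpsi Hy _ IH
                 |x y phi psi Hs Hpsi Hy _ IH]; intros k e.
  - now apply axiom_sound.
  - exact (IH2 k e k (stage_refl K k) (IH1 k e)).
  - intros k1 H1 Hf d.
    specialize (IH k (update e y d) k1 H1).
    rewrite force_subst, (force_update_fresh _ _ _ _ _ psi) in IH by assumption. specialize (IH Hf).
    revert IH. apply force_agree. intros z Hz. unfold update. simpl in Hy.
    rewrite Nat.eqb_refl. destruct (Nat.eqb_spec z x); [reflexivity|].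
    destruct (Nat.eqb_spec z y) as [->|]; [tauto|reflexivity].
  - intros k1 H1 [d Hf].
    specialize (IH k (update e y d) k1 H1).
    rewrite force_subst, (force_update_fresh _ _ _ _ _ psi) in IH by assumption.
    apply IH. revert Hf. apply force_agree. intros z Hz. unfold update. simpl in Hy.
    rewrite Nat.eqb_refl. destruct (Nat.eqb_spec z x); [reflexivity|].
    destruct (Nat.eqb_spec z y) as [->|]; [tauto|reflexivity].
Qed.

Lemma derives_sound Gamma phi k e :
  derives Gamma phi -> (forall gamma, Gamma gamma -> force true k e gamma) ->
  force true k e phi.
Proof.
  intros H HG. induction H as [phi H|phi H|phi psi _ IH1 _ IH2].
  - now apply HG.
  - now apply provable_sound.
  - exact (IH2 k (stage_refl K k) IH1).
Qed.

Lemma force_fold_or k e theta thetas :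
  force true k e (fold_left FOr thetas theta) ->
  exists t, List.In t (theta :: thetas) /\ force true k e t.
Proof.
  revert theta. induction thetas as [|t l IH]; intros theta H.
  - exists theta. split; [now left|exact H].
  - apply IH in H as (t' & [<-|Hin] & Hf).
    + destruct Hf; [exists theta|exists t]; simpl; auto.
    + exists t'. simpl. auto.
Qed.

End Forcing.

(** * Unravelling a model of FSK^d *)

Section Unravelling.

Variable M : fsk_model.

Notation W := (world M).
Notation node := (list (nat * W)).
Notation partial := (node -> option W).

Let le_refl (w : W) : le w w := @PreOrder_Reflexive _ _ (le_preorder M) w.
Let le_trans (u v w : W) (H : le u v) (H' : le v w) : le u w :=
  @PreOrder_Transitive _ _ (le_preorder M) u v w H H'.

Definition is_hom (f : partial) : Prop :=
  forall l s u, f (l :: s) = Some u -> exists w, f s = Some w /\ acc w u.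

Definition is_full (f : partial) : Prop :=
  forall s w u, f s = Some w -> acc w u -> exists l, f (l :: s) = Some u.

Definition bounded_by (N : nat) (f : partial) : Prop :=
  forall n u s, f ((n, u) :: s) <> None -> n < N.

Definition below (f g : partial) : Prop :=
  forall s w, f s = Some w -> exists w', g s = Some w' /\ le w w'.

(** A node is the path from the root to it, written backwards.  The label of a
    child consists of a tag and a world; [place_bound] leaves tags unused, so that
    a map can always be extended to new children. *)
Record unravelling : Type := {
  place :> node -> option W;
  place_hom : is_hom place;
  place_full : is_full place;
  place_bound : exists N, bounded_by N place
}.

(** Below each node in the domain of [f], this hangs the tree of all paths of
    accessible worlds, with the unused tag [N]. *)
Fixpoint fill (N : nat) (f : partial) (s : node) : option W :=
  match f s with
  | Some w => Some w
  | None =>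
      match s with
      | [] => None
      | (n, u) :: s' =>
          match fill N f s' with
          | Some w => if excluded_middle_informative (n = N /\ acc w u)
                      then Some u else None
          | None => None
          end
      end
  end.

Lemma fill_extends N f s w : f s = Some w -> fill N f s = Some w.
Proof. intros H. destruct s as [|[n u] s]; simpl; now rewrite H. Qed.

Lemma fill_cons N f n u s v :
  fill N f ((n, u) :: s) = Some v ->
  f ((n, u) :: s) = Some v \/
  n = N /\ v = u /\ exists w, fill N f s = Some w /\ acc w u.
Proof.
  simpl. destruct (f ((n, u) :: s)) as [v'|]; [now left|].
  destruct (fill N f s) as [w|]; [|discriminate].
  destruct (excluded_middle_informative _) as [[-> Hw]|]; [|discriminate].
  intros E. injection E as <-. right. split; [reflexivity|].
  split; [reflexivity|]. now exists w.
Qed.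

Lemma extend_to_unravelling (f : partial) N :
  is_hom f -> bounded_by N f ->
  exists g : unravelling, forall s w, f s = Some w -> g s = Some w.
Proof.
  intros Hhom HN.
  assert (H1 : is_hom (fill N f)).
  { intros [n u] s v Hv. apply fill_cons in Hv as [Hv|(-> & -> & w & Hw)]; [|now exists w].
    apply Hhom in Hv as (w & Hw & Hacc). exists w. split; [|exact Hacc].
    now apply fill_extends. }
  assert (H2 : is_full (fill N f)).
  { intros s w u Hw Hacc. exists (N, u). simpl.
    destruct (f ((N, u) :: s)) eqn:E.
    - assert (HNN : N < N) by (apply (HN N u s); congruence). lia.
    - rewrite Hw. destruct (excluded_middle_informative _) as [_|H]; [reflexivity|].
      now destruct H. }
  assert (H3 : bounded_by (S N) (fill N f)).
  { intros n u s H. destruct (fill N f ((n, u) :: s)) as [v|] eqn:E; [|easy].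
    apply fill_cons in E as [E|(-> & _)]; [|lia].
    assert (n < N) by (apply (HN n u s); congruence). lia. }
  exists (Build_unravelling (fill N f) H1 H2 (ex_intro _ (S N) H3)).
  intros s w. apply fill_extends.
Qed.

(** Going from a node to the root, the second confluence condition moves each
    ancestor upwards along with the node. *)
Lemma lift_ancestors (f : partial) s : is_hom f -> forall w w', f s = Some w -> le w w' ->
  exists P : partial,
    P s = Some w' /\ P [] <> None /\ is_hom P /\
    (forall t v, P t = Some v -> length t <= length s /\
       exists v0, f t = Some v0 /\ le v0 v).
Proof.
  intros Hhom. induction s as [|l s IH]; intros w w' Hw Hle.
  - exists (fun t => match t with [] => Some w' | _ => None end).
    split; [reflexivity|]. split; [discriminate|]. split; [discriminate|].
    intros [|l t] v E; [|discriminate E]. injection E as <-.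
    split; [constructor|]. now exists w.
  - destruct (Hhom _ _ _ Hw) as (u & Hu & Hacc).
    destruct (acc_back M _ _ _ Hacc Hle) as (u' & Hleu & Hacc').
    destruct (IH u u' Hu Hleu) as (P & P1 & P2 & P3 & P4).
    exists (fun t => if excluded_middle_informative (t = l :: s) then Some w' else P t).
    split; [|split; [|split]].
    + destruct (excluded_middle_informative _); [reflexivity|congruence].
    + destruct (excluded_middle_informative _); [discriminate|exact P2].
    + intros l' t v E.
      destruct (excluded_middle_informative (l' :: t = l :: s)) as [E'|_].
      * injection E' as -> ->. injection E as <-. exists u'. split; [|exact Hacc'].
        destruct (excluded_middle_informative _) as [E'|_]; [|exact P1].
        apply (f_equal (@length _)) in E'. simpl in E'. lia.
      * destruct (excluded_middle_informative (t = l :: s)) as [->|_]; [|now apply P3 in E].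
        apply P4 in E as [E _]. simpl in E. lia.
    + intros t v E. destruct (excluded_middle_informative _) as [->|_].
      * injection E as <-. split; [constructor|]. now exists w.
      * apply P4 in E as [E H]. split; [simpl; lia|exact H].
Qed.

(** The remaining nodes follow their parents, by the first confluence
    condition. *)
Lemma lift_along (f P : partial) :
  is_hom f -> is_hom P -> P [] <> None ->
  (forall t v, P t = Some v -> exists v0, f t = Some v0 /\ le v0 v) ->
  exists g : partial, is_hom g /\ below f g /\
    (forall t, g t <> None -> f t <> None) /\
    (forall t v, P t = Some v -> g t = Some v).
Proof.
  intros Hf HP Hroot HPf.
  set (choice (w' u : W) := epsilon (inhabits u) (fun u' => acc w' u' /\ le u u')).
  set (g := fix g (t : node) : option W :=
    match P t with
    | Some v => Some v
    | None =>
        match t with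
        | [] => None
        | l :: s =>
            match g s, f (l :: s) with
            | Some w', Some u => Some (choice w' u)
            | _, _ => None
            end
        end
    end).
  assert (gP : forall t v, P t = Some v -> g t = Some v).
  { intros t v H. destruct t; simpl; now rewrite H. }
  assert (gf : forall t, g t <> None -> f t <> None).
  { intros t. destruct (P t) as [v|] eqn:E.
    - intros _. apply HPf in E as (v0 & -> & _). discriminate.
    - destruct t as [|l s]; simpl; rewrite E; [easy|].
      destruct (g s); [|easy]. destruct (f (l :: s)); easy. }
  assert (Hchoice : forall w w' u, acc w u -> le w w' ->
    acc w' (choice w' u) /\ le u (choice w' u)).
  { intros w w' u H1 H2. apply (epsilon_spec (inhabits u) (fun u' => acc w' u' /\ le u u')).
    exact (acc_forth M _ _ _ H2 H1). }
  assert (Hbelow : below f g).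
  { intros t. induction t as [|l s IH]; intros u Hu.
    - destruct (P []) as [v|] eqn:E; [|easy].
      destruct (HPf _ _ E) as (v0 & Hv0 & Hle). exists v. split; [now apply gP|].
      congruence.
    - destruct (P (l :: s)) as [v|] eqn:E.
      + destruct (HPf _ _ E) as (v0 & Hv0 & Hle). exists v. split; [now apply gP|].
        congruence.
      + destruct (Hf _ _ _ Hu) as (w & Hw & Hacc).
        destruct (IH w Hw) as (w' & Hw' & Hle).
        exists (choice w' u). simpl. rewrite E, Hw', Hu.
        split; [reflexivity|]. now apply (Hchoice w). }
  exists g. split; [|now repeat split].
  intros l s u. simpl. destruct (P (l :: s)) as [v|] eqn:E.
  - intros Ev. injection Ev as <-. apply HP in E as (w & Hw & Hacc).
    exists w. split; [now apply gP|exact Hacc].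
  - destruct (g s) as [w'|] eqn:Ew; [|discriminate].
    destruct (f (l :: s)) as [u0|] eqn:Eu; [|discriminate].
    intros Ev. injection Ev as <-. exists w'. split; [reflexivity|].
    destruct (Hf _ _ _ Eu) as (w & Hw & Hacc).
    destruct (Hbelow _ _ Hw) as (w'' & Hw'' & Hle).
    assert (w'' = w') by congruence. subst. now apply (Hchoice w).
Qed.

(** The lifted map need not reach the successors of the worlds in its range that
    are new there, so it is filled up again. *)
Lemma lift (k : unravelling) s w w' :
  k s = Some w -> le w w' -> exists k' : unravelling, below k k' /\ k' s = Some w'.
Proof.
  intros Hw Hle. destruct (place_bound k) as [N HN].
  destruct (lift_ancestors k s (place_hom k) w w' Hw Hle) as (P & P1 & P2 & P3 & P4).
  destruct (lift_along k P (place_hom k) P3 P2) as (g & G1 & G2 & G3 & G4).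
  { intros t v H. now apply P4. }
  destruct (extend_to_unravelling g N G1) as [k' Hk'].
  { intros n u t H. apply (HN n u t). now apply G3. }
  exists k'. split; [|now apply Hk', G4].
  intros t v Hv. destruct (G2 t v Hv) as (v' & Hv' & H). exists v'. auto.
Qed.

Lemma below_refl (k : partial) : below k k.
Proof. intros s w H. exists w. split; [exact H|apply le_refl]. Qed.

Lemma below_trans (k1 k2 k3 : partial) : below k1 k2 -> below k2 k3 -> below k1 k3.
Proof.
  intros H1 H2 s w Hw. apply H1 in Hw as (w' & Hw' & Hle).
  apply H2 in Hw' as (w'' & Hw'' & Hle'). exists w''. split; [exact Hw''|].
  now apply (le_trans _ w').
Qed.

Definition unravelling_ext (sgn : bool) (Q : symbol) (ss : list node)
    (k : unravelling) : Prop :=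
  match sgn, Q, ss with
  | true, Sprop n, [s] => exists w, k s = Some w /\ Vpos n w
  | false, Sprop n, [s] => exists w, k s = Some w /\ Vneg n w
  | true, Sedge, [s; t] => exists l w, t = l :: s /\ k t = Some w
  | _, _, _ => False
  end.

Lemma unravelling_ext_up sgn Q ss (k k' : unravelling) :
  below k k' -> unravelling_ext sgn Q ss k -> unravelling_ext sgn Q ss k'.
Proof.
  intros Hk. destruct sgn, Q, ss as [|s [|t [|? ?]]]; simpl; try tauto.
  - intros (w & Hw & H). apply Hk in Hw as (w' & Hw' & Hle).
    exists w'. split; [exact Hw'|]. now apply (Vpos_up M _ w).
  - intros (l & w & -> & Hw). apply Hk in Hw as (w' & Hw' & _). eauto.
  - intros (w & Hw & H). apply Hk in Hw as (w' & Hw' & Hle).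
    exists w'. split; [exact Hw'|]. now apply (Vneg_up M _ w).
Qed.

Definition unravelled : kripke := {|
  stage := unravelling;
  stage_le := below;
  stage_refl := below_refl;
  stage_trans := fun k1 k2 k3 => below_trans k1 k2 k3;
  individual := node;
  extension := unravelling_ext;
  extension_up := unravelling_ext_up
|}.

Section Truth.

Variable other : nat -> nat.
Hypothesis other_neq : forall x, other x <> x.

Lemma unravelled_truth phi : forall a (k : unravelling) (e : nat -> node) w,
  k (e a) = Some w ->
  (force unravelled true k e (std_trans other a phi) <-> sat_pos M w phi) /\
  (force unravelled false k e (std_trans other a phi) <-> sat_neg M w phi).
Proof.
  induction phi as [n|phi IH1 psi IH2|phi IH1 psi IH2|phi IH1 psi IH2|phi IH|phi IH];
    intros a k e w Hw; simpl.
  - split; split; try (intros (w' & Hw' & H); congruence); exists w; auto.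
  - destruct (IH1 a k e w Hw), (IH2 a k e w Hw). tauto.
  - destruct (IH1 a k e w Hw), (IH2 a k e w Hw). tauto.
  - split; [|destruct (IH1 a k e w Hw), (IH2 a k e w Hw); tauto]. split.
    + intros H v Hv Hphi. destruct (lift k (e a) w v Hw Hv) as (k' & Hk & Hk').
      apply (IH2 a k' e v Hk'), (H k' Hk), (IH1 a k' e v Hk'), Hphi.
    + intros H k' Hk Hphi. destruct (Hk _ _ Hw) as (v & Hv & Hle).
      apply (IH2 a k' e v Hv), (H v Hle), (IH1 a k' e v Hv), Hphi.
  - destruct (IH a k e w Hw). tauto.
  - set (y := other a).
    assert (Ea : forall d : node, update e y d a = e a).
    { intros d. unfold update, y. destruct (Nat.eqb_spec a (other a)) as [E|_]; [|easy].
      now destruct (other_neq a). }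
    assert (Ey : forall d : node, update e y d y = d).
    { intros d. unfold update. now rewrite Nat.eqb_refl. }
    split; split.
    + intros H v u Hv Hacc. destruct (lift k (e a) w v Hw Hv) as (k' & Hk & Hk').
      destruct (place_full k' _ _ _ Hk' Hacc) as [l Hl].
      apply (IH y k' (update e y (l :: e a))); [now rewrite Ey|].
      apply (H (l :: e a) k' Hk). rewrite Ea, Ey. eauto.
    + intros H d k' Hk. rewrite Ea, Ey. intros (l & u & -> & Hu).
      destruct (place_hom k' _ _ _ Hu) as (v & Hv & Hacc).
      destruct (Hk _ _ Hw) as (v' & Hv' & Hle).
      apply (IH y k' _ u); [now rewrite Ey|]. apply (H v u); [congruence|exact Hacc].
    + intros (d & HE & Hd). rewrite Ea, Ey in HE. destruct HE as (l & u & -> & Hu).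
      destruct (place_hom k _ _ _ Hu) as (v & Hv & Hacc).
      exists u. split; [congruence|]. apply (IH y k _ u) in Hd; [exact Hd|now rewrite Ey].
    + intros (u & Hacc & Hu). destruct (place_full k _ _ _ Hw Hacc) as [l Hl].
      exists (l :: e a). rewrite Ea, Ey. split; [eauto|].
      apply (IH y k _ u); [now rewrite Ey|exact Hu].
Qed.

Lemma unravelling_at (w : W) : exists k : unravelling, k [] = Some w.
Proof.
  destruct (extend_to_unravelling
    (fun s => match s with [] => Some w | _ => None end) 0) as [k Hk].
  - discriminate.
  - intros n u s H. now destruct H.
  - exists k. now apply Hk.
Qed.

End Truth.

End Unravelling.

Lemma QN4_to_FSKd (other : nat -> nat) (other_neq : forall x, other x <> x)
    (Gamma Delta : Ensemble MD) x :
  QN4_conseq (Im MD FO Gamma (std_trans other x)) (Im MD FO Delta (std_trans other x)) ->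
  FSKd_conseq Gamma Delta.
Proof.
  rewrite QN4_conseq_iff. intros (theta & thetas & Ht & Hts & Hd) (M & w & HG & HD).
  destruct (unravelling_at M w) as [k Hk].
  set (e := fun _ : nat => @nil (nat * world M)).
  apply (derives_sound (unravelled M) _ _ k e) in Hd.
  - apply force_fold_or in Hd as (t & Hin & Hf).
    assert (H : In FO (Im MD FO Delta (std_trans other x)) t).
    { rewrite Forall_forall in Hts. destruct Hin as [<-|Hin]; auto. }
    destruct H as [psi Hpsi t ->]. apply (HD psi Hpsi).
    now apply (unravelled_truth M other other_neq psi x k e w Hk).
  - intros gamma [phi Hphi t ->].
    apply (unravelled_truth M other other_neq phi x k e w Hk). now apply HG.
Qed.

Theorem theorem2 (other : nat -> nat) (other_neq : forall x, other x <> x)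
    (Gamma Delta : Ensemble MD) (x : nat) :
  FSKd_conseq Gamma Delta <->
  QN4_conseq (Im MD FO Gamma (std_trans other x))
             (Im MD FO Delta (std_trans other x)).
Proof.
  split; [now apply FSKd_to_QN4|now apply QN4_to_FSKd].
Qed.
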